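(* Let $a,b$ be real numbers with $1<a<b$. Then $$\pi=\frac2a\sqrt{\frac{(b^2-a^2)(1-a^2b^2)}{1-b^4}}\;\frac{(1+b^2)\,K\!\left(\dfrac{b(a^2-1)}{a(b^2-1)}\right)+(1-b^2)\,K\!\left(\dfrac{b(a^2+1)}{a(b^2+1)}\right)}{F_D^{(3)}\!\left(\tfrac12;\tfrac12,\tfrac12,\tfrac12;2\,\Big|\,\dfrac1{1-b^4},\dfrac1{1-a^2b^2},\dfrac{a^2}{a^2-b^2}\right)}.$$
   Context: $K(k)=\int_0^1\frac{dx}{\sqrt{(1-x^2)(1-k^2x^2)}}$ is the complete elliptic integral of the first kind, as a function of the modulus $k$. The Lauricella function of $n$ variables is $F_D^{(n)}(\alpha;\beta_1,\dots,\beta_n;\gamma\,|\,x_1,\dots,x_n)=\sum_{m_1,\dots,m_n\ge0}\frac{(\alpha)_{m_1+\cdots+m_n}(\beta_1)_{m_1}\cdots(\beta_n)_{m_n}}{(\gamma)_{m_1+\cdots+m_n}\,m_1!\cdots m_n!}x_1^{m_1}\cdots x_n^{m_n}$ for $|x_j|<1$, with $(x)_k$ the Pochhammer symbol. For $\operatorname{Re}\gamma>\operatorname{Re}\alpha>0$ it equals, and outside the region of convergence is defined by analytic continuation through, $\frac{\Gamma(\gamma)}{\Gamma(\alpha)\Gamma(\gamma-\alpha)}\int_0^1\frac{u^{\alpha-1}(1-u)^{\gamma-\alpha-1}}{(1-x_1u)^{\beta_1}\cdots(1-x_nu)^{\beta_n}}\,du$ (principal branches, $x_j\notin[1,\infty)$).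 *)

(* Defs.v *)
From HB Require Import structures.
From mathcomp Require Import all_boot all_order all_algebra.
From mathcomp Require Import all_classical all_reals all_analysis.

Set Implicit Arguments.
Unset Strict Implicit.
Unset Printing Implicit Defensive.

Import Order.TTheory GRing.Theory Num.Theory.
Import numFieldNormedType.Exports.

Local Open Scope classical_set_scope.
Local Open Scope ring_scope.

(* All integrals are Lebesgue integrals. The integrands below are nonnegative,
   so that the improper integrals (at 0, 1 or infinity) agree with them; the
   junk values of the integrands at singular endpoints lie on a null set. *)

(* Complete elliptic integral of the first kind; the argument is the modulus
   k, not the parameter k ^+ 2. *)
Definition ellipticK (R : realType) (k : R) : R :=
  \int[@lebesgue_measure R]_(x in `[0, 1])
    (Num.sqrt ((1 - x ^+ 2) * (1 - k ^+ 2 * x ^+ 2)))^-1.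

(* Euler's integral, for s > 0. *)
Definition Gamma (R : realType) (s : R) : R :=
  \int[@lebesgue_measure R]_(t in `]0, +oo[) (t `^ (s - 1) * expR (- t)).

Definition pochhammer (R : realType) (x : R) (k : nat) : R :=
  \prod_(i < k) (x + i%:R).

Definition lauricellaD_term (R : realType) (n : nat)
    (alpha : R) (beta : n.-tuple R) (gamma : R) (x : n.-tuple R)
    (m : 'I_n -> nat) : R :=
  (pochhammer alpha (\sum_j m j)%N * \prod_j pochhammer (tnth beta j) (m j))
  / (pochhammer gamma (\sum_j m j)%N * \prod_j ((m j)`!)%:R)
  * \prod_j (tnth x j ^+ m j).

(* The multiple series converges absolutely when |x_j| < 1 for all j, so its
   sum is the limit of the partial sums over the cubes {0, ..., N - 1}^n. *)
Definition lauricellaD_series (R : realType) (n : nat)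
    (alpha : R) (beta : n.-tuple R) (gamma : R) (x : n.-tuple R) : R :=
  limn (fun N : nat => \sum_(m : {ffun 'I_n -> 'I_N})
    lauricellaD_term alpha beta gamma x (fun j => m j : nat)).

(* Meaningful for 0 < alpha < gamma and x_j < 1 for all j: the bases
   1 - x_j * u are then positive on [0, 1[, where the real power `^ is the
   principal branch. *)
Definition lauricellaD_integral (R : realType) (n : nat)
    (alpha : R) (beta : n.-tuple R) (gamma : R) (x : n.-tuple R) : R :=
  Gamma gamma / (Gamma alpha * Gamma (gamma - alpha)) *
  \int[@lebesgue_measure R]_(u in `[0, 1])
    (u `^ (alpha - 1) * (1 - u) `^ (gamma - alpha - 1)
     / \prod_j ((1 - tnth x j * u) `^ tnth beta j)).

(* Lauricella's F_D with real parameters and arguments: the series in its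
   region of convergence, and its analytic continuation outside of it. *)
Definition lauricellaD (R : realType) (n : nat)
    (alpha : R) (beta : n.-tuple R) (gamma : R) (x : n.-tuple R) : R :=
  if [forall j, `|tnth x j| < 1] then lauricellaD_series alpha beta gamma x
  else lauricellaD_integral alpha beta gamma x.

(* Main.v *)
Require Import Defs.
From mathcomp Require Import all_boot all_order all_algebra.
From mathcomp Require Import all_classical all_reals all_analysis.
From mathcomp Require Import measurable_realfun ring lra.

Set Implicit Arguments.
Unset Strict Implicit.
Unset Printing Implicit Defensive.

Import Order.TTheory GRing.Theory Num.Theory.
Import numFieldNormedType.Exports.

Local Open Scope classical_set_scope.
Local Open Scope ring_scope.

(** For alpha = beta_j = 1/2 and gamma = 2 the factor in front of Euler's
    integral is Gamma(2) / (Gamma(1/2) Gamma(3/2)) = 2 / pi. The theorem thus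
    says that the hyperelliptic integral

      I = int_0^1 sqrt((1 - u) / u) / prod_j sqrt(1 - x_j u) du

    is a combination of two complete elliptic integrals. The substitution
    u = 1 - b^2 s^2 turns it into a multiple of the integral over ]0, 1/b[ of

      2 s^2 / sqrt(Q(s)),
      Q(s) = (1 - b^2 s^2) (1 - s^2 / b^2) (1 - a^2 s^2) (1 - s^2 / a^2),

    where s^-4 Q(s) depends on s^2 + s^-2 only. For sigma = 1 and sigma = -1 the
    variable z = s^-1 - sigma s satisfies z^2 = s^2 + s^-2 - 2 sigma and
    dz = - s^-2 (1 + sigma s^2) ds, so that (1 + sigma s^2) ds / sqrt(Q(s))
    becomes an elliptic differential in z, and its integral a multiple of K at
    the modulus (a - sigma / a) / (b - sigma / b), one of the two moduli of the
    statement ([ellipticK_palindromic]). Since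
    2 s^2 = (1 + s^2) - (1 - s^2), the integral I is a difference of the two
    values of K ([integral_euler_palindromic]), and the theorem follows because
    I is positive ([euler_integral_gt0]).

    When b^2 > 2 a^2 all the arguments of F_D have absolute value less than 1,
    and F_D is then given by its series. That the series agrees with Euler's
    integral ([lauricellaD_series_half]) comes from the binomial series of
    (1 - x)^(-1/2) ([cvg_binom_half]), integrated term by term against the
    weight sqrt((1 - u) / u), whose moments are Wallis integrals
    ([integral_beta_half]).

    The integrands are nonnegative and may be singular at the ends of the
    interval; [ge0_change_of_variables] is the substitution rule suited to
    them. *)

(** * Differentiation and continuity on segments *)

(** The pointwise form of the power rule: instance search does not see through
    [fun t => f t ^+ n] when the exponent is a variable. *)
Lemma is_derive_exprn (R : realType) (f : R -> R) (n : nat) (x df : R) :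
  is_derive x 1 f df ->
  is_derive x 1 (fun t => f t ^+ n) (n%:R * f x ^+ n.-1 * df).
Proof.
move=> dfx; have -> : (fun t => f t ^+ n) = f ^+ n.
  by apply/funext => t; rewrite exprfctE.
exact: is_deriveX.
Qed.

Section derivable_on_segment.
Context {R : realType}.
Variables (F f : R -> R) (a b : R).
Hypotheses (ab : a < b).
Hypothesis dF : forall x, x \in `[a, b] -> is_derive x 1 F (f x).

Lemma derivable_within_segment : {within `[a, b], continuous F}.
Proof. by apply: derivable_within_continuous => x xab; have [] := dF xab. Qed.

Lemma derivable_segment_LRcontinuous : derivable_oo_LRcontinuous F a b.
Proof.
have /(continuous_within_itvP _ ab)[_ Fa Fb] := derivable_within_segment.
by split => // x /subset_itv_oo_cc xab; have [] := dF xab.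
Qed.

Lemma derive1_segment : {in `]a, b[, derive1 F =1 f}.
Proof.
by move=> x /subset_itv_oo_cc xab; rewrite derive1E; have [] := dF xab.
Qed.

End derivable_on_segment.

Lemma is_derive_continuous (R : realType) (F : R -> R) (x l : R) :
  is_derive x 1 F l -> {for x, continuous F}.
Proof. by move=> [dF _]; exact/differentiable_continuous/derivable1_diffP. Qed.

Lemma continuous_within_segment (R : realType) (F : R -> R) (a b : R) :
  (forall x, x \in `[a, b] -> {for x, continuous F}) ->
  {within `[a, b], continuous F}.
Proof.
by move=> cF; apply: continuous_in_subspaceT => x; rewrite inE; exact: cF.
Qed.

Lemma continuous_segment_integrable (R : realType) (f : R -> R) (a b : R) :
  {within `[a, b], continuous f} ->
  (@lebesgue_measure R).-integrable `[a, b] (EFin \o f).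
Proof. by apply: continuous_compact_integrable; exact: segment_compact. Qed.

(** * Change of variables for nonnegative integrands *)

Section change_of_variables.
Context {R : realType}.
Local Notation mu := (@lebesgue_measure R).
Implicit Types (F f G : R -> R) (a b : R).

(** Both signs of the derivative are kept in one statement, at the price of an
    absolute value, because the two sides of the final comparison run through
    their common parameter in opposite directions. *)
Lemma segment_change_of_variables F f G a b :
  a < b ->
  (forall x, x \in `[a, b] ->
    \forall y \near x, is_derive (y : R) (1 : R) F (f y)) ->
  (forall x, x \in `[a, b] -> {for x, continuous f}) ->
  (forall x, x \in `[a, b] -> 0 < f x) \/
    (forall x, x \in `[a, b] -> f x < 0) ->
  (forall x, x \in `[a, b] -> {for F x, continuous G}) ->
  measurable (F @` `[a, b]) /\
  (\int[mu]_(x in F @` `[a, b]) (G x)%:E =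
   \int[mu]_(x in `[a, b]) (G (F x) * `|f x|)%:E)%E.
Proof.
move=> ab dF cf sf cG.
have dF1 x : x \in `[a, b] -> is_derive x 1 F (f x).
  by move=> xab; exact: nbhs_singleton (dF x xab).
have F'f x : x \in `[a, b] -> \forall y \near x, f y = (derive1 F) y.
  move=> xab; apply: filterS (dF x xab) => y dy.
  by rewrite derive1E; apply/esym; exact: derive_val.
have oc x : x \in `]a, b[ -> x \in `[a, b] by exact: subset_itv_oo_cc.
have aab : a \in `[a, b] by rewrite bound_itvE ltW.
have bab : b \in `[a, b] by rewrite bound_itvE ltW.
have cF' x : x \in `[a, b] -> (derive1 F) y @[y --> x] --> f x.
  move=> xab; apply: cvg_trans (cf x xab).
  exact: near_eq_cvg (F'f x xab).
have F'E x : x \in `[a, b] -> (derive1 F) x = f x.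
  by move=> xab; rewrite (nbhs_singleton (F'f x xab)).
have cF : {within `[a, b], continuous F}.
  by apply: derivable_within_continuous => x xab; have [] := dF1 x xab.
have dLR : derivable_oo_LRcontinuous F a b.
  have /(continuous_within_itvP _ ab)[_ Fa Fb] := cF.
  by split => // x /oc xab; have [] := dF1 x xab.
have cF'oo : {in `]a, b[, continuous (derive1 F)}.
  by move=> x /oc xab; rewrite /continuous_at F'E//; exact: cF'.
have cF'a : cvg ((derive1 F) x @[x --> a^'+]).
  by apply/cvg_ex; exists (f a); apply: cvg_at_right_filter; exact: cF'.
have cF'b : cvg ((derive1 F) x @[x --> b^'-]).
  by apply/cvg_ex; exists (f b); apply: cvg_at_left_filter; exact: cF'.
have mvt x y : x \in `[a, b] -> y \in `[a, b] -> x < y ->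
    exists2 c, c \in `[a, b] & F y - F x = f c * (y - x).
  move=> xab yab xy.
  have sub z : z \in `[x, y] -> z \in `[a, b].
    rewrite !in_itv/= => /andP[xz zy].
    by rewrite (le_trans _ xz) ?(le_trans zy) ?(itvP xab) ?(itvP yab).
  have xyF z : z \in `]x, y[ -> is_derive z 1 F (f z).
    by move=> /subset_itv_oo_cc/sub/dF1.
  have cxyF : {within `[x, y], continuous F}.
    by apply: derivable_within_continuous => t /sub tab; have [] := dF1 t tab.
  have [c cxy Fxy] := MVT_segment (ltW xy) xyF cxyF.
  by exists c => //; exact: sub.
case: sf => sf.
- have Finc : {in `[a, b] &, {homo F : x y / x < y}}.
    move=> x y xab yab xy; have [c cab Fxy] := mvt x y xab yab xy.
    by rewrite -subr_gt0 Fxy mulr_gt0 ?sf// subr_gt0.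
  have Fle : {in `[a, b] &, {homo F : x y / x <= y}}.
    move=> x y xab yab; rewrite le_eqVlt => /predU1P[->//|xy].
    by apply: ltW; exact: Finc.
  have FaFb : F a <= F b by rewrite Fle// ltW.
  rewrite inc_surj_image_segment//; last 2 first.
    exact: ltW.
    by apply: segment_continuous_le_surjective => //; exact: ltW.
  split => //.
  rewrite (integration_by_substitution_increasing (ltW ab) Finc)//.
  + apply: eq_integral => x; rewrite inE/= => xab.
    by rewrite !fctE F'E// gtr0_norm ?sf.
  + apply: continuous_in_subspaceT => y; rewrite inE/= => yab.
    have /(_ y yab)[x xab <-] :=
      segment_continuous_le_surjective (ltW ab) FaFb cF.
    exact: cG.
- have Fdec : {in `[a, b] &, {homo F : x y /~ x < y}}.
    move=> x y xab yab xy; have [c cab Fxy] := mvt y x yab xab xy.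
    by rewrite -subr_lt0 Fxy nmulr_rlt0 ?sf// subr_gt0.
  have Fle : {in `[a, b] &, {homo F : x y /~ x <= y}}.
    move=> x y xab yab; rewrite le_eqVlt => /predU1P[->//|yx].
    by apply: ltW; exact: Fdec.
  have FbFa : F b <= F a by rewrite Fle// ltW.
  rewrite dec_surj_image_segment//; last 2 first.
    exact: ltW.
    by apply: segment_continuous_ge_surjective => //; exact: ltW.
  split => //.
  rewrite (integration_by_substitution_decreasing (ltW ab) Fdec)//.
  + apply: eq_integral => x; rewrite inE/= => xab.
    by rewrite !fctE F'E// ltr0_norm ?sf.
  + apply: continuous_in_subspaceT => y; rewrite inE/= => yab.
    have /(_ y yab)[x xab <-] :=
      segment_continuous_ge_surjective (ltW ab) FbFa cF.
    exact: cG.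
Qed.

(** Exhausting the domain by segments and passing to the limit by monotone
    convergence allows integrands that blow up at the ends of the domain, as
    most integrands below do, as well as unbounded domains. *)
Lemma ge0_change_of_variables F f G (c d : R^nat) :
  let I := \bigcup_n `[c n, d n]%classic in
  (forall n, c n < d n) ->
  nonincreasing_seq c -> nondecreasing_seq d -> open I ->
  (forall x, I x -> is_derive x 1 F (f x)) ->
  (forall x, I x -> {for x, continuous f}) ->
  (forall x, I x -> 0 < f x) \/ (forall x, I x -> f x < 0) ->
  (forall x, I x -> {for F x, continuous G}) ->
  (forall x, I x -> 0 <= G (F x)) ->
  (\int[mu]_(x in F @` I) (G x)%:E =
   \int[mu]_(x in I) (G (F x) * `|f x|)%:E)%E.
Proof.
move=> I cd cn dn oI dF cf sf cG G0.
have subI n x : x \in `[c n, d n] -> I x by exists n.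
have seg n : measurable (F @` `[c n, d n]) /\
  (\int[mu]_(x in F @` `[c n, d n]) (G x)%:E =
   \int[mu]_(x in `[c n, d n]) (G (F x) * `|f x|)%:E)%E.
  apply: segment_change_of_variables => //.
  - move=> x xcd; have Ix := subI _ _ xcd.
    have : \forall y \near x, I y by exact: open_nbhs_nbhs.
    by apply: filterS; exact: dF.
  - by move=> x /subI; exact: cf.
  - by case: sf => sf; [left|right] => x /subI; exact: sf.
  - by move=> x /subI; exact: cG.
have ndI : nondecreasing_seq (fun n => `[c n, d n]%classic).
  move=> m n mn; apply/subsetPset => x /=; rewrite !in_itv/= => /andP[cx xd].
  by rewrite (le_trans (cn _ _ mn) cx) (le_trans xd (dn _ _ mn)).
have ndFI : nondecreasing_seq (fun n => F @` `[c n, d n]).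
  by move=> m n /ndI/subsetPset mn; apply/subsetPset; exact: image_subset.
have cGFf x : I x -> {for x, continuous (fun x => G (F x) * `|f x|)}.
  move=> Ix; apply: cvgM; last by apply: cvg_norm; exact: cf.
  apply: continuous_comp (cG x Ix).
  apply: differentiable_continuous; apply/derivable1_diffP.
  by have [] := dF x Ix.
have /(cvg_lim (@ereal_hausdorff R)) <- : (\int[mu]_(x in `[c n, d n])
    (G (F x) * `|f x|)%:E @[n --> \oo] -->
    \int[mu]_(x in I) (G (F x) * `|f x|)%:E)%E.
  apply: ge0_nondecreasing_set_cvg_integral => //.
  - move=> n; apply/measurable_EFinP.
    apply: subspace_continuous_measurable_fun => //.
    apply: continuous_in_subspaceT => x; rewrite inE/= => /subI; exact: cGFf.
  - by move=> n x /subI Ix; rewrite lee_fin mulr_ge0// G0.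
rewrite image_bigcup; apply/esym/cvg_lim => //.
under eq_cvg do rewrite -(seg _).2.
apply: ge0_nondecreasing_set_cvg_integral => //.
- by move=> n; exact: (seg n).1.
- move=> n; apply/measurable_EFinP.
  apply: subspace_continuous_measurable_fun; first exact: (seg n).1.
  by apply: continuous_in_subspaceT => _ /[!inE] /= -[x /subI Ix <-]; exact: cG.
- by move=> n _ [x /subI Ix <-]; rewrite lee_fin G0.
Qed.

End change_of_variables.

Lemma itvoo_bigcup_segments (R : realType) (a b : R) : a < b ->
  `]a, b[%classic =
  \bigcup_n `[a + (b - a) / n.+3%:R, b - (b - a) / n.+3%:R]%classic.
Proof.
move=> ab; have ba : 0 < b - a by rewrite subr_gt0.
have e0 (n : nat) : 0 < (b - a) / n.+3%:R by rewrite divr_gt0.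
apply/seteqP; split => [x/=|x [n _]/=]; rewrite !in_itv/=; last first.
  move=> /andP[ax xb]; rewrite (lt_le_trans _ ax) ?ltrDl ?e0//=.
  by rewrite (le_lt_trans xb)// ltrBlDr ltrDl e0.
move=> /andP[ax xb]; pose m := Num.min (x - a) (b - x).
have m0 : 0 < m by rewrite lt_min !subr_gt0 ax xb.
have [n nm] : exists n : nat, (b - a) / n.+3%:R < m.
  exists (Num.truncn ((b - a) / m)); rewrite ltr_pdivrMr// mulrC -ltr_pdivrMr//.
  by rewrite (lt_trans (truncnS_gt _))// ltr_nat.
exists n => //=; rewrite in_itv/=.
by move: nm; rewrite lt_min => /andP[n1 n2]; apply/andP; split;
  [rewrite -lerBrDl|rewrite lerBrDr -lerBrDl]; exact: ltW.
Qed.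

Lemma itvoy_bigcup_segments (R : realType) :
  `]0 : R, +oo[%classic = \bigcup_n `[n.+1%:R^-1, n.+2%:R : R]%classic.
Proof.
apply/seteqP; split => [x/=|x [n _]/=]; rewrite !in_itv/= ?andbT; last first.
  by move=> /andP[+ _]; apply: lt_le_trans; rewrite invr_gt0.
move=> x0; exists (maxn (Num.truncn x) (Num.truncn x^-1)) => //=.
rewrite in_itv/=; apply/andP; split.
  rewrite -[leRHS]invrK lef_pV2 ?posrE ?invr_gt0//.
  by rewrite (le_trans (ltW (truncnS_gt _)))// ler_nat ltnS leq_maxr.
by rewrite (le_trans (ltW (truncnS_gt _)))// ler_nat ltnS leqW// leq_maxl.
Qed.

Section change_of_variables_itvoo.
Context {R : realType}.
Local Notation mu := (@lebesgue_measure R).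
Variables (F f G : R -> R) (a b : R).
Hypotheses (ab : a < b) (cF : {within `[a, b], continuous F}).
Hypothesis dF : forall x, x \in `]a, b[ -> is_derive x 1 F (f x).
Hypothesis cf : forall x, x \in `]a, b[ -> {for x, continuous f}.

Lemma ge0_change_of_variables_itvoo :
  (forall x, x \in `]a, b[ -> 0 < f x) \/
    (forall x, x \in `]a, b[ -> f x < 0) ->
  (forall x, x \in `]a, b[ -> {for F x, continuous G}) ->
  (forall x, x \in `]a, b[ -> 0 <= G (F x)) ->
  (\int[mu]_(x in F @` `]a, b[) (G x)%:E =
   \int[mu]_(x in `]a, b[) (G (F x) * `|f x|)%:E)%E.
Proof.
have ba : 0 < b - a by rewrite subr_gt0.
have n3 (n : nat) : (3 : R) <= n.+3%:R by rewrite ler_nat.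
have le3 (m n : nat) : (m <= n)%N -> (b - a) / n.+3%:R <= (b - a) / m.+3%:R.
  by move=> mn; rewrite ler_pM2l// lef_pV2 ?posrE// ler_nat.
move: dF cf => + + sf cG G0.
rewrite (itvoo_bigcup_segments ab) => dF' cf'.
have inI x :
    (\bigcup_n `[a + (b - a) / n.+3%:R, b - (b - a) / n.+3%:R]%classic) x ->
    x \in `]a, b[.
  by rewrite -itvoo_bigcup_segments.
apply: ge0_change_of_variables.
- move=> n.
  have : (b - a) / n.+3%:R <= (b - a) / 3.
    by rewrite ler_pM2l// lef_pV2 ?posrE.
  by move: (_ / n.+3%:R) => e; lra.
- by move=> m n mn; rewrite lerD2l le3.
- by move=> m n mn; rewrite lerD2l lerN2 le3.
- by rewrite -itvoo_bigcup_segments//; exact: interval_open.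
- by move=> x /inI; exact: dF.
- by move=> x /inI; exact: cf.
- by case: sf => sf; [left|right] => x /inI; exact: sf.
- by move=> x /inI; exact: cG.
- by move=> x /inI; exact: G0.
Qed.

Lemma strict_monotonic_image_itvoo :
  {in `[a, b] &, {homo F : x y / x < y}} \/
    {in `[a, b] &, {homo F : x y /~ x < y}} ->
  F @` `]a, b[ = F @`]a, b[%classic.
Proof.
move=> Fmono; apply/seteqP; split.
  by move=> _ [x xab <-]; exact: mono_mem_image_itvoo.
move=> y /= yF; have yF' : (F @`[a, b]%classic) y by exact: subset_itv_oo_cc.
have [x xab xy] := segment_continuous_surjective (ltW ab) cF yF'.
exists x => //; move: xab yF; rewrite -xy /= !in_itv/= => /andP[].
rewrite le_eqVlt => /predU1P[<- _|ax].
  by rewrite gt_min lt_max !ltxx; case: ltgtP.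
rewrite le_eqVlt => /predU1P[->|->]; last by rewrite ax.
by rewrite gt_min lt_max !ltxx; case: ltgtP.
Qed.


Hypotheses (cG : forall x, x \in `]a, b[ -> {for F x, continuous G})
  (G0 : forall x, x \in `]a, b[ -> 0 <= G (F x)).

Lemma increasing_ge0_change_of_variables :
  (forall x, x \in `]a, b[ -> 0 < f x) ->
  (\int[mu]_(x in `]F a, F b[) (G x)%:E =
   \int[mu]_(x in `]a, b[) (G (F x) * f x)%:E)%E.
Proof.
move=> f0; have Finc : {in `[a, b] &, {homo F : x y / x < y}}.
  apply: gtr0_derive1_lt_cc => // x xab; first by have [] := dF xab.
  by rewrite derive1E (@derive_val _ _ _ _ _ _ _ (dF xab)) f0.
have FaFb : F a < F b by apply: Finc => //; rewrite bound_itvE ltW.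
have -> : `]F a, F b[%classic = F @` `]a, b[.
  by rewrite strict_monotonic_image_itvoo; [rewrite min_l ?max_r// ltW|left].
rewrite ge0_change_of_variables_itvoo//; last by left.
by apply: eq_integral => x; rewrite inE/= => xab; rewrite gtr0_norm ?f0.
Qed.

Lemma decreasing_ge0_change_of_variables :
  (forall x, x \in `]a, b[ -> f x < 0) ->
  (\int[mu]_(x in `]F b, F a[) (G x)%:E =
   \int[mu]_(x in `]a, b[) (G (F x) * - f x)%:E)%E.
Proof.
move=> f0; have Fdec : {in `[a, b] &, {homo F : x y /~ x < y}}.
  apply: ltr0_derive1_lt_cc => // x xab; first by have [] := dF xab.
  by rewrite derive1E (@derive_val _ _ _ _ _ _ _ (dF xab)) f0.
have FbFa : F b < F a by apply: Fdec => //; rewrite bound_itvE ltW.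
have -> : `]F b, F a[%classic = F @` `]a, b[.
  by rewrite strict_monotonic_image_itvoo; [rewrite min_r ?max_l// ltW|right].
rewrite ge0_change_of_variables_itvoo//; last by right.
by apply: eq_integral => x; rewrite inE/= => xab; rewrite ltr0_norm ?f0.
Qed.

End change_of_variables_itvoo.

(** * The Gamma function *)

Section Gamma.
Context {R : realType}.
Local Notation mu := (@lebesgue_measure R).
Implicit Types (s x t : R).

Let integrand s t := t `^ (s - 1) * expR (- t).

Lemma continuous_powR s x : 0 < x -> {for x, continuous (fun t => t `^ s)}.
Proof. by move=> x0; exact: is_derive_continuous (is_derive1_powR s x0). Qed.

Lemma Gamma_integrand_ge0 s t : 0 <= integrand s t.
Proof. by rewrite mulr_ge0 ?powR_ge0 ?expR_ge0. Qed.

Lemma continuous_Gamma_integrand s t :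
  0 < t -> {for t, continuous (integrand s)}.
Proof.
move=> t0; apply: cvgM; first exact: continuous_powR.
by apply: continuous_comp; [exact: continuousN|exact: continuous_expR].
Qed.

(** From [1 + y <= expR y] at [y = t / (s + 1)], raised to the power
    [s + 1]. *)
Lemma powR_expRN_le s t : 0 < s -> 0 < t ->
  t `^ s * expR (- t) <= (s + 1) `^ (s + 1) / t.
Proof.
move=> s0 t0; have s1 : 0 < s + 1 by rewrite addr_gt0.
have e0 := expR_gt0 (t / (s + 1)).
have -> : - t = t / (s + 1) * (- (s + 1)) by field; rewrite gt_eqF.
rewrite expRM powRN ler_pdivrMr ?powR_gt0// mulrAC ler_pdivlMr//.
have -> : t `^ s * t = t `^ (s + 1).
  by rewrite powRD ?(gt_eqF t0) ?implybT// powRr1// ltW.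
rewrite -powRM ?(ltW s1) ?(ltW e0)//; apply: ge0_ler_powR;
  rewrite ?nnegrE ?mulr_ge0 ?(ltW s1) ?(ltW e0) ?(ltW t0)//.
rewrite -ler_pdivrMl// mulrC.
by apply: le_trans (expR_ge1Dx _); rewrite lerDr.
Qed.

Lemma cvgy_powR_expRN s : 0 < s -> t `^ s * expR (- t) @[t --> +oo] --> 0.
Proof.
move=> s0; apply: (@squeeze_cvgr _ _ _ _ (cst 0)
  (fun t => (s + 1) `^ (s + 1) / t)); last 2 first.
- exact: cvg_cst.
- rewrite -[X in _ --> X](mulr0 ((s + 1) `^ (s + 1))).
  apply: cvgM; first exact: cvg_cst.
  apply/gtr0_cvgV0; first by near=> t; near: t; exact: nbhs_pinfty_gt.
  exact: cvg_id.
near=> t; rewrite mulr_ge0 ?powR_ge0 ?expR_ge0//=.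
by rewrite powR_expRN_le//; near: t; exact: nbhs_pinfty_gt.
Unshelve. all: end_near. Qed.

Lemma cvg0_powR_expRN s : 0 < s -> t `^ s * expR (- t) @[t --> 0^'+] --> 0.
Proof.
move=> s0; rewrite -[X in _ --> X](mul0r (expR (- 0))).
apply: cvgM; first exact: powR_cvg0.
apply: cvg_at_right_filter.
by apply: continuous_comp; [exact: continuousN|exact: continuous_expR].
Qed.

Let gam s := (\int[mu]_(t in `]0%R, +oo[) (integrand s t)%:E)%E.

Let gam_segment s (n : nat) :=
  (\int[mu]_(t in `[(n.+1%:R^-1)%R, n.+2%:R%R]) (integrand s t)%:E)%E.

Let cvg_gam s : gam_segment s n @[n --> \oo] --> gam s.
Proof.
rewrite /gam itvoy_bigcup_segments; apply: ge0_nondecreasing_set_cvg_integral.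
- move=> m n mn; apply/subsetPset => x /=; rewrite !in_itv/= => /andP[mx xm].
  rewrite (le_trans _ mx) ?(le_trans xm)//.
    by rewrite ler_nat !ltnS.
  by rewrite lef_pV2 ?posrE// ler_nat.
- by [].
- move=> n; apply/measurable_EFinP.
  apply: subspace_continuous_measurable_fun => //.
  apply: continuous_within_segment => x; rewrite in_itv/= => /andP[nx _].
  by apply: continuous_Gamma_integrand; apply: lt_le_trans nx.
- by move=> n x _; rewrite lee_fin Gamma_integrand_ge0.
Qed.

Let gam_segmentD1 s n : 0 < s ->
  (gam_segment (s + 1) n = (n.+1%:R^-1 `^ s * expR (- n.+1%:R^-1) -
                            n.+2%:R `^ s * expR (- n.+2%:R))%:E +
                           s%:E * gam_segment s n)%E.
Proof.
move=> s0; rewrite /gam_segment.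
have ab : n.+1%:R^-1 < n.+2%:R :> R.
  rewrite (@le_lt_trans _ _ 1) ?ltr1n// invf_le1// ler1n//.
have gt0 x : x \in `[n.+1%:R^-1, n.+2%:R] -> 0 < x.
  by rewrite in_itv/= => /andP[nx _]; apply: lt_le_trans nx.
have dF x : x \in `[n.+1%:R^-1, n.+2%:R] ->
    is_derive x 1 (fun t => t `^ s) (s * x `^ (s - 1)).
  by move=> /gt0; exact: is_derive1_powR.
have dG x : x \in `[n.+1%:R^-1, n.+2%:R] ->
    is_derive x 1 (fun t => - expR (- t)) (expR (- x)).
  by move=> _; apply: is_derive_eq; rewrite mulrN1 opprK.
under eq_integral do rewrite /integrand addrK.
rewrite (@integration_by_parts R _ (fun t => - expR (- t))
  (fun t => s * t `^ (s - 1)) (fun t => expR (- t)) _ _ ab); last 6 first.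
- apply: continuous_within_segment => x /gt0 x0.
  by apply: cvgM; [exact: cvg_cst|exact: continuous_powR].
- exact: derivable_segment_LRcontinuous dF.
- exact: derive1_segment dF.
- apply: continuous_within_segment => x _.
  by apply: continuous_comp; [exact: continuousN|exact: continuous_expR].
- exact: derivable_segment_LRcontinuous dG.
- exact: derive1_segment dG.
congr (_ + _)%E; first by congr (_%:E); ring.
under eq_integral do rewrite mulrN -mulrA EFinN.
rewrite integral_ge0N ?oppeK; last first.
  by move=> x _; rewrite lee_fin mulr_ge0 ?Gamma_integrand_ge0// ltW.
under eq_integral do rewrite EFinM.
rewrite ge0_integralZl_EFin//.
- by move=> x _; rewrite lee_fin Gamma_integrand_ge0.
- apply/measurable_EFinP.
  apply: subspace_continuous_measurable_fun => //.
  apply: continuous_within_segment => x /gt0 x0.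
  exact: continuous_Gamma_integrand.
- exact: ltW.
Qed.

(* The boundary terms of the integration by parts vanish at both ends, while
   the integrals over the segments increase to the two Gamma integrals; working
   in the extended reals makes a proof of convergence unnecessary. *)
Let gamD1 s : 0 < s -> gam (s + 1) = (s%:E * gam s)%E.
Proof.
move=> s0; rewrite -(cvg_lim (@ereal_hausdorff R) (@cvg_gam (s + 1))).
rewrite (funext (fun n => gam_segmentD1 n s0)) -[RHS]add0e.
apply/cvg_lim => //; apply: cvgeD.
- by rewrite fin_num_adde_defr.
- apply/cvg_EFin; first exact: nearW.
  rewrite -[X in _ --> X](subr0 0); apply: cvgB.
    move/cvg_at_rightP : (cvg0_powR_expRN s0); apply; split.
      by move=> n; rewrite invr_gt0.
    exact: cvg_harmonic.
  move/cvg_pinftyP : (cvgy_powR_expRN s0); apply.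
  apply/cvgryPge => M; near=> n; rewrite (@le_trans _ _ n%:R)//.
    by near: n; exact: nbhs_infty_ger.
  by rewrite ler_nat ltnW.
- by apply: cvgeZl => //; exact: cvg_gam.
Unshelve. all: end_near. Qed.

Lemma GammaD1 s : 0 < s -> Gamma (s + 1) = s * Gamma s.
Proof.
move=> s0; rewrite /Gamma /Rintegral [X in fine X](gamD1 s0) -/(gam s).
have : (0 <= gam s)%E.
  by apply: integral_ge0 => x _; rewrite lee_fin Gamma_integrand_ge0.
by case: (gam s) => [r||]//= _; rewrite gt0_muley ?lte_fin//= mulr0.
Qed.

Lemma Gamma1 : Gamma (1 : R) = 1.
Proof.
rewrite /Gamma /Rintegral.
under eq_integral do rewrite subrr powRr0 mul1r.
rewrite integral_itv_obnd_cbnd; last first.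
  apply/measurable_EFinP; apply: measurable_funTS.
  apply: continuous_measurable_fun => x.
  by apply: continuous_comp; [exact: continuousN|exact: continuous_expR].
have cN (x : R) : {for x, continuous (fun t : R => - expR (- t))}.
  apply: cvgN.
  by apply: continuous_comp; [exact: continuousN|exact: continuous_expR].
rewrite (@ge0_continuous_FTC2y _ _ (fun x => - expR (- x)) _ 0)//.
- by rewrite oppr0 expR0 EFinN oppeK add0e.
- apply: continuous_subspaceT => x.
  by apply: continuous_comp; [exact: continuousN|exact: continuous_expR].
- by rewrite -oppr0; apply: cvgN; exact: cvgr_expR.
- by apply: cvg_at_right_filter; exact: cN.
- by move=> x _; rewrite derive1E derive_val mulrN1 opprK.
Qed.

(** The substitution [t = x ^+ 2] turns the integral into the Gaussian one. *)
Lemma Gamma_half : Gamma (2^-1 : R) = Num.sqrt pi.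
Proof.
rewrite /Gamma /Rintegral.
have sqr_image : (fun x : R => x ^+ 2) @` `]0, +oo[ = `]0, +oo[%classic.
  apply/seteqP; split => [_ [x + <-]|x] /=; rewrite !in_itv/= !andbT.
    by rewrite in_itv/= andbT => x0; exact: exprn_gt0.
  move=> x0; exists (Num.sqrt x); last by rewrite sqr_sqrtr// ltW.
  by rewrite /= in_itv/= andbT sqrtr_gt0.
transitivity (fine (\int[mu]_(x in `]0%R, +oo[)
    (integrand 2^-1 (x ^+ 2) * `|2 * x|)%:E)%E).
  congr fine; rewrite -[in LHS]sqr_image itvoy_bigcup_segments.
  apply: (@ge0_change_of_variables R (fun x => x ^+ 2) (fun x => 2 * x)
    (integrand 2^-1) (fun n => n.+1%:R^-1) (fun n => n.+2%:R)).
  - move=> n; rewrite (@le_lt_trans _ _ 1) ?ltr1n// invf_le1// ler1n//.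
  - by move=> m n mn; rewrite lef_pV2 ?posrE// ler_nat.
  - by move=> m n mn; rewrite ler_nat !ltnS.
  - by rewrite -itvoy_bigcup_segments; exact: interval_open.
  - by move=> x _; apply: is_derive_eq; rewrite /GRing.scale/=; ring.
  - by move=> x _; apply: cvgM; [exact: cvg_cst|exact: cvg_id].
  - left => x; rewrite -itvoy_bigcup_segments/= in_itv/= andbT => x0.
    by rewrite mulr_gt0.
  - move=> x; rewrite -itvoy_bigcup_segments/= in_itv/= andbT => x0.
    by apply: continuous_Gamma_integrand; rewrite exprn_gt0.
  - by move=> x _; exact: Gamma_integrand_ge0.
transitivity (fine (\int[mu]_(x in `[0%R, +oo[) (2%:E * (gauss_fun x)%:E))%E).
  rewrite -integral_itv_obnd_cbnd; last first.
    apply/measurable_EFinP; apply: measurable_funTS.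
    apply: measurable_funM => //.
    exact: measurable_gauss_fun.
  congr fine; apply: eq_integral => x; rewrite inE/= in_itv/= andbT => x0.
  rewrite -EFinM /integrand /gauss_fun; congr EFin.
  have -> : 2^-1 - 1 = - 2^-1 :> R by field.
  rewrite powRN powR12_sqrt ?sqr_ge0// sqrtr_sqr gtr0_norm//.
  rewrite gtr0_norm ?mulr_gt0//.
  by field; rewrite gt_eqF.
rewrite ge0_integralZl_EFin//.
+ by rewrite integral0y_gauss -EFinM mulrCA divff ?mulr1.
+ by move=> x _; rewrite lee_fin gauss_fun_ge0.
+ apply/measurable_EFinP; apply: measurable_funTS.
  exact: measurable_gauss_fun.
Qed.

End Gamma.

(** * The moments of sqrt((1 - u) / u) *)

Lemma pochhammerS (R : realType) (x : R) (m : nat) :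
  pochhammer x m.+1 = pochhammer x m * (x + m%:R).
Proof. by rewrite /pochhammer big_ord_recr. Qed.

Lemma pochhammer_gt0 (R : realType) (x : R) (m : nat) :
  0 < x -> 0 < pochhammer x m.
Proof. by move=> x0; apply: prodr_gt0 => i _; rewrite ltr_pwDl. Qed.

Section wallis.
Context {R : realType}.
Local Notation mu := (@lebesgue_measure R).
Implicit Types (x t u : R) (m n : nat).

Let wallis m t := 2 * sin t ^+ m.*2 * cos t ^+ 2.

Let continuous_wallis m : continuous (wallis m).
Proof.
move=> x; apply: cvgM; first apply: cvgM.
- exact: cvg_cst.
- apply: (@continuous_comp _ _ _ sin (fun y => y ^+ m.*2)).
    exact: continuous_sin.
  exact: exprn_continuous.
- apply: (@continuous_comp _ _ _ cos (fun y => y ^+ 2)).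
    exact: continuous_cos.
  exact: exprn_continuous.
Qed.

Let integrable_wallis m : mu.-integrable `[0, pi / 2] (EFin \o wallis m).
Proof.
apply: continuous_segment_integrable; apply: continuous_subspaceT.
exact: continuous_wallis.
Qed.

Let Wallis m := \int[mu]_(t in `[0, pi / 2]) wallis m t.

Let pihalf_gt0 : 0 < pi / 2 :> R.
Proof. by rewrite divr_gt0// pi_gt0. Qed.

Let Wallis0 : Wallis 0 = pi / 2.
Proof.
have dF x : x \in `[0, pi / 2] ->
    is_derive x 1 (fun t => t + sin t * cos t) (wallis 0 x).
  move=> _; apply: is_derive_eq.
  rewrite /wallis/= expr0 mulr1 /GRing.scale/=.
  by have := cos2Dsin2 x; nra.
rewrite /Wallis /Rintegral.
rewrite (@continuous_FTC2 _ _ (fun t => t + sin t * cos t))//.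
- by rewrite /= cos_pihalf sin0 mulr0 mul0r !addr0 subr0.
- by apply: continuous_subspaceT; exact: continuous_wallis.
- exact: derivable_segment_LRcontinuous dF.
- exact: derive1_segment dF.
Qed.

(* The two sides differ by the integral of the derivative of
   2 sin^(2m+1) cos^3, which vanishes at 0 and at pi / 2. *)
Let WallisS m : (m.*2.+4)%:R * Wallis m.+1 = (m.*2.+1)%:R * Wallis m.
Proof.
pose F t := 2 * sin t ^+ m.*2.+1 * cos t ^+ 3.
pose f t := m.*2.+1%:R * wallis m t - m.*2.+4%:R * wallis m.+1 t.
have dF x : x \in `[0, pi / 2] -> is_derive x 1 F (f x).
  move=> _; have dsin := is_derive_exprn m.*2.+1 (is_derive_sin x).
  have dcos := is_derive_exprn 3 (is_derive_cos x).
  rewrite /F; apply: is_derive_eq.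
  rewrite /f /wallis doubleS /GRing.scale/= ![sin x ^+ _.+1]exprS.
  have -> : m.*2.+1%:R = m.*2%:R + 1 :> R by rewrite -natr1.
  have -> : m.*2.+4%:R = m.*2%:R + 4 :> R by rewrite -addn4 natrD.
  apply/eqP; rewrite -subr_eq0; apply/eqP.
  transitivity (2 * sin x ^+ m.*2 * cos x ^+ 2 * (m.*2%:R + 1) *
                (cos x ^+ 2 - (1 - sin x ^+ 2))); first by ring.
  by rewrite cos2sin2 subrr mulr0.
apply/eqP; rewrite eq_sym -subr_eq0; apply/eqP.
rewrite /Wallis -!RintegralZl// -RintegralB//; last 2 first.
- apply: continuous_segment_integrable; apply: continuous_subspaceT => x.
  by apply: cvgM; [exact: cvg_cst|exact: continuous_wallis].
- apply: continuous_segment_integrable; apply: continuous_subspaceT => x.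
  by apply: cvgM; [exact: cvg_cst|exact: continuous_wallis].
rewrite /Rintegral (@continuous_FTC2 _ f F)//.
- by rewrite /F /= cos_pihalf sin0 !exprS !(mul0r, mulr0) subr0.
- apply: continuous_subspaceT => x.
  by apply: cvgB; apply: cvgM; try exact: cvg_cst; exact: continuous_wallis.
- exact: derivable_segment_LRcontinuous dF.
- exact: derive1_segment dF.
Qed.

Let WallisE m : Wallis m = pi / 2 * (pochhammer 2^-1 m / pochhammer 2 m).
Proof.
elim: m => [|m IH].
  by rewrite Wallis0 /pochhammer !big_ord0 invr1 !mulr1.
have p2 := @pochhammer_gt0 R 2 m (ltr0Sn R 1).
have /(canRL (mulKf _)) -> := WallisS m; last by rewrite pnatr_eq0.
rewrite IH !pochhammerS.
have -> : m.*2.+1%:R = 2 * (2^-1 + m%:R) :> R.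
  by rewrite -addn1 -muln2 natrD natrM; field.
have -> : m.*2.+4%:R = 2 * (2 + m%:R) :> R.
  by rewrite -addn4 -muln2 natrD natrM; ring.
field; rewrite gt_eqF//= gt_eqF//.
Qed.

(** The substitution [u = sin t ^+ 2] gives the integrals of
    2 sin^(2m) cos^2 over a quarter period. *)
Lemma integral_beta_half m :
  (\int[mu]_(u in `]0%R, 1%R[) (u ^+ m * (Num.sqrt (1 - u) / Num.sqrt u))%:E =
  (pi / 2 * (pochhammer 2^-1 m / pochhammer 2 m))%:E)%E.
Proof.
have := @increasing_ge0_change_of_variables R (fun t => sin t ^+ 2)
  (fun t => 2 * sin t * cos t)
  (fun u => u ^+ m * (Num.sqrt (1 - u) / Num.sqrt u)) _ _ pihalf_gt0.
rewrite sin0 sin_pihalf expr0n expr1n/= => subst.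
etransitivity.
  apply: subst.
  - apply: continuous_subspaceT => x.
    apply: (@continuous_comp _ _ _ sin (fun y => y ^+ 2)).
      exact: continuous_sin.
    exact: exprn_continuous.
  - move=> x _; apply: is_derive_eq; rewrite /GRing.scale/=; ring.
  - move=> x _; apply: cvgM; last exact: continuous_cos.
    by apply: cvgM; [exact: cvg_cst|exact: continuous_sin].
  - move=> x; rewrite in_itv/= => /andP[x0 x2].
    have s0 : 0 < sin x by rewrite sin_gt0_pihalf// x0.
    apply: cvgM; first exact: exprn_continuous.
    apply: cvgM.
      apply: (@continuous_comp _ _ _ (fun u => 1 - u) Num.sqrt).
        by apply: cvgB; [exact: cvg_cst|exact: cvg_id].
      exact: sqrt_continuous.
    apply: cvgV; last exact: sqrt_continuous.
    by rewrite gt_eqF// sqrtr_gt0 exprn_gt0.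
  - move=> x _; apply: mulr_ge0; first by rewrite exprn_ge0// sqr_ge0.
    by rewrite divr_ge0 ?sqrtr_ge0.
  - move=> x; rewrite in_itv/= => /andP[x0 x2].
    rewrite !mulr_gt0// ?sin_gt0_pihalf ?x0//.
    by rewrite cos_gt0_pihalf// x2 (lt_trans _ x0)// oppr_lt0.
rewrite -WallisE /Wallis /Rintegral fineK; last first.
  by apply: integrable_fin_num => //; exact: integrable_wallis.
rewrite [RHS]integral_itv_bndoo; last first.
  apply/measurable_EFinP; apply: measurable_funTS.
  exact: continuous_measurable_fun.
apply: eq_integral => x; rewrite inE/= in_itv/= => /andP[x0 x2].
have s0 : 0 < sin x by rewrite sin_gt0_pihalf// x0.
have c0 : 0 < cos x.
  by rewrite cos_gt0_pihalf// x2 (lt_trans _ x0)// oppr_lt0.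
rewrite -cos2sin2 !sqrtr_sqr !gtr0_norm// /wallis -exprM mul2n.
by congr EFin; field; rewrite gt_eqF.
Qed.

End wallis.

(** * The binomial series of (1 - x)^(-1/2) *)

Section binomial_series.
Context {R : realType}.
Implicit Types (x r : R) (m N : nat).

(** With [t = - n * ln r] this is the decay of [t * expR (- t)]. *)
Lemma cvg_natr_exprn r : 0 < r < 1 -> n%:R * r ^+ n @[n --> \oo] --> 0.
Proof.
move=> /andP[r0 r1]; have l0 : 0 < - ln r by rewrite oppr_gt0 ln_lt0// r0.
have uoo : n%:R * - ln r @[n --> \oo] --> +oo.
  exact: cvg_comp (@cvgr_idn R) (gt0_cvgMly l0 cvg_id).
have /cvg_pinftyP/(_ _ uoo) u0 := @cvgy_powR_expRN R 1 ltr01.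
rewrite -[X in _ --> X](mul0r (- ln r)^-1).
under eq_fun => n.
  rewrite (_ : n%:R * r ^+ n =
    (n%:R * - ln r) `^ 1 * expR (- (n%:R * - ln r)) * (- ln r)^-1); last first.
    rewrite powRr1 ?mulr_ge0 ?(ltW l0)// mulrN opprK expRM_natl lnK//.
    by field; rewrite lt_eqF// -oppr_gt0.
  over.
by apply: cvgM => //; exact: cvg_cst.
Qed.

(** The Taylor coefficients of (1 - x)^(-1/2) at 0. *)
Definition binom_half_coef m : R := pochhammer 2^-1 m / m`!%:R.

Local Notation c := binom_half_coef.

Lemma binom_half_coefS m : m.+1%:R * c m.+1 = (m%:R + 2^-1) * c m.
Proof.
rewrite /c pochhammerS factS natrM; field.
by rewrite nat1r !pnatr_eq0 -lt0n fact_gt0.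
Qed.

Lemma binom_half_coef_ge0 m : 0 <= c m.
Proof. by rewrite divr_ge0// ltW// pochhammer_gt0. Qed.

Lemma binom_half_coef_le1 m : c m <= 1.
Proof.
elim: m => [|m IH]; first by rewrite /c /pochhammer big_ord0 divr1.
rewrite -(ler_pM2l (ltr0Sn R m)) binom_half_coefS mulr1.
apply: (@le_trans _ _ (m%:R + 2^-1)).
  by rewrite ler_piMr// addr_ge0.
by rewrite -[leRHS]natr1 lerD2l invf_le1// ler1n.
Qed.

Definition binom_half N x := \sum_(m < N) c m * x ^+ m.

Lemma binom_half_bounded N x r : `|x| <= r -> r < 1 ->
  `|binom_half N x| <= (1 - r)^-1.
Proof.
move=> xr r1; have r0 : 0 <= r by apply: le_trans xr.
apply: (@le_trans _ _ (\sum_(m < N) r ^+ m)).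
  apply: le_trans (ler_norm_sum _ _ _) _; apply: ler_sum => m _.
  rewrite normrM normrX (ger0_norm (binom_half_coef_ge0 _)).
  rewrite -[leRHS]mul1r ler_pM ?binom_half_coef_ge0 ?binom_half_coef_le1//.
  by rewrite lerXn2r ?nnegrE.
have r1' : 0 < 1 - r by rewrite subr_gt0.
rewrite -(ler_pM2l r1') divff ?gt_eqF// -[1 - r]opprB mulNr -subrX1 opprB.
by rewrite gerBl exprn_ge0.
Qed.

Lemma is_derive_binom_half N x :
  is_derive x 1 (binom_half N) (\sum_(m < N) c m * (m%:R * x ^+ m.-1)).
Proof.
elim: N => [|N IH].
  rewrite big_ord0 (_ : binom_half 0 = cst 0); first exact: is_derive_cst.
  by apply/funext => y; rewrite /binom_half big_ord0.
rewrite big_ord_recr/= (_ : binom_half N.+1 =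
    fun y => binom_half N y + c N * y ^+ N).
  have dX := is_derive_exprn N (is_derive_id x 1).
  by apply: is_derive_eq; rewrite /GRing.scale/=; ring.
by apply/funext => y; rewrite /binom_half big_ord_recr.
Qed.

(** The function y = (1 - x)^(-1/2) solves (1 - x) y' = y / 2, and a partial sum
    of its series solves it up to its last term. *)
Lemma binom_half_ode N x :
  (1 - x) * (\sum_(m < N.+1) c m * (m%:R * x ^+ m.-1)) - binom_half N.+1 x / 2 =
  - ((N%:R + 2^-1) * c N * x ^+ N).
Proof.
elim: N => [|N IH].
  by rewrite /binom_half !big_ord_recr !big_ord0/= !expr0; field.
rewrite /binom_half !(big_ord_recr N.+1)/= -/(binom_half N.+1 x).
set S := \sum_(_ < _) _ in IH *; set P := binom_half _ _ in IH *.
have split (t u : R) : (1 - x) * (S + t) - (P + u) / 2 =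
  ((1 - x) * S - P / 2) + ((1 - x) * t - u / 2) by ring.
rewrite split IH -binom_half_coefS exprS -natr1.
by field.
Qed.

(** By [binom_half_ode], the product of the partial sum by sqrt (1 - x) has a
    derivative bounded by a multiple of (N + 1) r^N as long as
    [`|x| <= r < 1]; as this product is 1 at 0, the mean value theorem shows
    that it tends to 1. *)
Lemma cvg_binom_half x : `|x| < 1 ->
  binom_half N x @[N --> \oo] --> (Num.sqrt (1 - x))^-1.
Proof.
move=> x1; pose r := (1 + `|x|) / 2.
have xr : `|x| <= r by rewrite /r ler_pdivlMr//; lra.
have r1 : r < 1 by rewrite /r ltr_pdivrMr//; lra.
have r0 : 0 < r by rewrite /r divr_gt0// ltr_wpDr.
have pos y : `|y| <= r -> 0 < 1 - y.
  by move=> yr; rewrite subr_gt0 (le_lt_trans (ler_norm _))// (le_lt_trans yr).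
have r1' : 0 < 1 - r by rewrite subr_gt0.
pose g N y := binom_half N.+1 y * Num.sqrt (1 - y).
pose g' N y := - ((N%:R + 2^-1) * c N * y ^+ N) / Num.sqrt (1 - y).
have dg N (y : R) : `|y| <= r -> is_derive y 1 (g N) (g' N y).
  move=> yr; have y0 := pos y yr.
  have dP := is_derive_binom_half N.+1 y.
  have d1 : is_derive y 1 (fun z : R => 1 - z) (- 1).
    by apply: is_derive_eq; rewrite add0r mul1r.
  have dS := @is_derive1_comp R Num.sqrt (fun z => 1 - z) y _ _
    (is_derive1_sqrt y0) d1.
  apply: (is_derive_eq (is_deriveM dP dS)).
  rewrite /g' -binom_half_ode /GRing.scale/=.
  have s0 : 0 < Num.sqrt (1 - y) by rewrite sqrtr_gt0.
  rewrite -[X in (X * _ - _) / _](sqr_sqrtr (ltW y0)).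
  by field; rewrite gt_eqF.
have g'_le N y : `|y| <= r ->
    `|g' N y| <= (N%:R + 1) * r ^+ N / Num.sqrt (1 - r).
  move=> yr; rewrite /g' normrM normfV normrN (normrM (_ * c N)).
  rewrite (normrM _ (c N)) normrX.
  rewrite (ger0_norm (sqrtr_ge0 _)) (ger0_norm (binom_half_coef_ge0 _)).
  move: (c N) (binom_half_coef_ge0 N) (binom_half_coef_le1 N) => k k0 k1.
  rewrite ger0_norm ?addr_ge0//; apply: ler_pM.
  - by rewrite !mulr_ge0 ?addr_ge0 ?exprn_ge0.
  - by rewrite invr_ge0 sqrtr_ge0.
  - apply: ler_pM; rewrite ?mulr_ge0 ?addr_ge0 ?exprn_ge0//.
      rewrite -[leRHS]mulr1; apply: ler_pM => //.
      by rewrite lerD2l invf_le1// ler1n.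
    by rewrite lerXn2r ?nnegrE// ltW.
  - rewrite lef_pV2 ?posrE ?sqrtr_gt0 ?(pos y)//.
    by rewrite ler_wsqrtr// lerD2l lerN2 (le_trans (ler_norm _)).
have g1 N : g N 0 = 1.
  rewrite /g subr0 sqrtr1 mulr1 /binom_half big_ord_recl /= expr0 mulr1.
  rewrite big1 ?addr0; first by rewrite /c /pochhammer big_ord0 divr1.
  by move=> i _; rewrite expr0n mulr0.
have g_le N : `|g N x - 1| <= (N%:R + 1) * r ^+ N / Num.sqrt (1 - r).
  have [y yr ->] : exists2 y, `|y| <= r & g N x - 1 = g' N y * x.
    rewrite -(g1 N); have [x0|x0] := leP 0 x.
    - have le z : z \in `[0, x] -> `|z| <= r.
        rewrite in_itv/= => /andP[z0 zx]; rewrite ger0_norm//.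
        by rewrite (le_trans zx)// (le_trans (ler_norm _)).
      have dg' z : z \in `]0, x[ -> is_derive z 1 (g N) (g' N z).
        by move=> /subset_itv_oo_cc/le; exact: dg.
      have cg := @derivable_within_segment R (g N) (g' N) 0 x
        (fun z zx => dg N z (le z zx)).
      have [y /le yr E] := MVT_segment x0 dg' cg.
      by exists y; rewrite // E subr0.
    - have le z : z \in `[x, 0] -> `|z| <= r.
        rewrite in_itv/= => /andP[z0 zx]; rewrite ler0_norm//.
        by rewrite (le_trans _ xr)// ltr0_norm// lerN2.
      have dg' z : z \in `]x, 0[ -> is_derive z 1 (g N) (g' N z).
        by move=> /subset_itv_oo_cc/le; exact: dg.
      have cg := @derivable_within_segment R (g N) (g' N) x 0
        (fun z zx => dg N z (le z zx)).
      have [y /le yr E] := MVT_segment (ltW x0) dg' cg.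
      by exists y; rewrite // -opprB E; ring.
  rewrite normrM -[leRHS]mulr1 ler_pM// ?g'_le//.
  exact: ltW.
have bound0 : (N%:R + 1) * r ^+ N / Num.sqrt (1 - r) @[N --> \oo] --> 0.
  rewrite -[X in _ --> X](mul0r (Num.sqrt (1 - r))^-1).
  apply: cvgM; last exact: cvg_cst.
  rewrite -[X in _ --> X](addr0 0); under eq_fun do rewrite mulrDl mul1r.
  apply: cvgD; first by apply: cvg_natr_exprn; rewrite r0.
  by apply: cvg_expr; rewrite ger0_norm// ltW.
have gcvg : g N x @[N --> \oo] --> (1 : R).
  apply/cvgrPdist_le => e e0.
  have /cvgrPdist_le/(_ e e0) := bound0.
  apply: filterS => N; rewrite sub0r normrN => /(le_trans (ler_norm _)).
  by rewrite distrC; apply: le_trans.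
have s0 : 0 < Num.sqrt (1 - x) by rewrite sqrtr_gt0 pos.
have : g N x / Num.sqrt (1 - x) @[N --> \oo] --> 1 / Num.sqrt (1 - x).
  by apply: cvgM => //; exact: cvg_cst.
rewrite mul1r (_ : (fun N => g N x / _) = (fun N => binom_half N.+1 x)).
  by rewrite (cvg_shiftS (fun N => binom_half N x)).
by apply/funext => N; rewrite /g mulfK// gt_eqF.
Qed.

End binomial_series.

(** * Lauricella's function as an Euler integral *)

Section lauricella_half.
Context {R : realType}.
Local Notation mu := (@lebesgue_measure R).
Implicit Types (u r : R) (n N : nat).

(** The weight of Euler's integral for alpha = 1/2 and gamma = 2; up to the
    change of variable [u = v ^+ 2] it is the area element of a half disc. *)
Definition semicircle_weight u : R := Num.sqrt (1 - u) / Num.sqrt u.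

Local Notation w := semicircle_weight.

(** Euler's integrand for alpha = beta_j = 1/2 and gamma = 2. *)
Definition euler_integrand n (x : n.-tuple R) u : R :=
  w u / \prod_j Num.sqrt (1 - tnth x j * u).

Lemma semicircle_weight_ge0 u : 0 <= w u.
Proof. by rewrite divr_ge0 ?sqrtr_ge0. Qed.

Lemma euler_integrand_ge0 n (x : n.-tuple R) u : 0 <= euler_integrand x u.
Proof.
by rewrite divr_ge0 ?semicircle_weight_ge0// prodr_ge0.
Qed.

Lemma continuous_sqrt_affine (c u : R) :
  {for u, continuous (fun v => Num.sqrt (1 - c * v))}.
Proof.
apply: (@continuous_comp _ _ _ (fun v : R => 1 - c * v) Num.sqrt).
  apply: cvgB; first exact: cvg_cst.
  by apply: cvgM; [exact: cvg_cst|exact: cvg_id].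
exact: sqrt_continuous.
Qed.

Lemma continuous_semicircle_weight u : 0 < u -> {for u, continuous w}.
Proof.
move=> u0; apply: cvgM.
  apply: (@continuous_comp _ _ _ (fun v : R => 1 - v) Num.sqrt).
    by apply: cvgB; [exact: cvg_cst|exact: cvg_id].
  exact: sqrt_continuous.
by apply: cvgV; [rewrite gt_eqF// sqrtr_gt0|exact: sqrt_continuous].
Qed.

Lemma onem_mul_gt0 (c u : R) : c < 1 -> 0 < u -> u < 1 -> 0 < 1 - c * u.
Proof. by move=> c1 u0 u1; nra. Qed.

Lemma continuous_euler_integrand n (x : n.-tuple R) u :
  (forall j, tnth x j < 1) -> 0 < u -> u < 1 ->
  {for u, continuous (euler_integrand x)}.
Proof.
move=> x1 u0 u1; apply: cvgM; first exact: continuous_semicircle_weight.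
apply: cvgV.
  apply/prodf_neq0 => j _; rewrite gt_eqF// sqrtr_gt0.
  exact: onem_mul_gt0.
apply: cvg_big => [|j _]; first exact: mul_continuous.
exact: continuous_sqrt_affine.
Qed.

Lemma measurable_euler_integrand n (x : n.-tuple R) :
  (forall j, tnth x j < 1) -> measurable_fun `]0 : R, 1[ (euler_integrand x).
Proof.
move=> x1; apply: subspace_continuous_measurable_fun => //.
apply: continuous_in_subspaceT => u; rewrite inE/= in_itv/= => /andP[u0 u1].
exact: continuous_euler_integrand.
Qed.

Lemma integrable_moment m :
  mu.-integrable `]0 : R, 1[ (fun u => (u ^+ m * w u)%:E).
Proof.
apply/integrableP; split.
  apply/measurable_EFinP; apply: subspace_continuous_measurable_fun => //.
  apply: continuous_in_subspaceT => u; rewrite inE/= in_itv/= => /andP[u0 _].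
  apply: cvgM; first exact: exprn_continuous.
  exact: continuous_semicircle_weight.
have -> : (\int[mu]_(u in `]0%R, 1%R[) `|(u ^+ m * w u)%:E| =
    \int[mu]_(u in `]0%R, 1%R[) (u ^+ m * w u)%:E)%E.
  apply: eq_integral => u; rewrite inE/= in_itv/= => /andP[u0 _].
  by rewrite ger0_norm// mulr_ge0 ?semicircle_weight_ge0// exprn_ge0// ltW.
by rewrite integral_beta_half ltry.
Qed.

(** A sum over a cube of multi-indices of a product is a product of sums; this
    is what makes the cubic partial sums convenient. *)
Lemma prod_binom_half n (x : n.-tuple R) N u :
  \prod_j binom_half N (tnth x j * u) =
  \sum_(m : {ffun 'I_n -> 'I_N})
    (\prod_j (binom_half_coef (m j) * tnth x j ^+ m j)) * u ^+ (\sum_j m j)%N.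
Proof.
rewrite /binom_half bigA_distr_bigA; apply: eq_bigr => m _.
rewrite -prodrXr -big_split/=; apply: eq_bigr => j _.
by rewrite exprMn mulrA.
Qed.

(** The quotient of Pochhammer symbols at the total degree is a moment of the
    weight, which accounts for the factor pi / 2. *)
Lemma lauricellaD_termE n (beta x : n.-tuple R) (m : 'I_n -> nat) :
  (forall j, tnth beta j = 2^-1) ->
  pi / 2 * lauricellaD_term 2^-1 beta 2 x m =
  \prod_j (binom_half_coef (m j) * tnth x j ^+ m j) *
  (pi / 2 * (pochhammer 2^-1 (\sum_j m j)%N / pochhammer 2 (\sum_j m j)%N)).
Proof.
move=> beta_half; rewrite /lauricellaD_term.
rewrite (eq_bigr (fun j => pochhammer 2^-1 (m j))) => [|j _]; last first.
  by rewrite beta_half.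
rewrite big_split/= /binom_half_coef big_split/= prodfV.
have p2 := @pochhammer_gt0 R 2 (\sum_j m j)%N (ltr0Sn R 1).
field; rewrite gt_eqF//=; apply/prodf_neq0 => j _.
by rewrite pnatr_eq0 -lt0n fact_gt0.
Qed.

Lemma integral_partial_sum n (beta x : n.-tuple R) N :
  (forall j, tnth beta j = 2^-1) ->
  (\int[mu]_(u in `]0%R, 1%R[)
    (w u * \prod_j binom_half N (tnth x j * u))%:E =
  (pi / 2 * \sum_(m : {ffun 'I_n -> 'I_N})
    lauricellaD_term 2^-1 beta 2 x (fun j => m j : nat))%:E)%E.
Proof.
move=> beta_half.
under eq_integral do rewrite prod_binom_half mulr_sumr -sumEFin.
rewrite mulr_sumr -sumEFin integral_sum//=; last first.
  move=> m; pose a := \prod_j (binom_half_coef (m j) * tnth x j ^+ m j).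
  apply: eq_integrable
    (integrableZl _ a (integrable_moment (\sum_j m j)%N)) => //.
  by move=> u _; rewrite -EFinM/=; congr EFin; rewrite -/a; ring.
apply: eq_bigr => m _.
rewrite lauricellaD_termE// EFinM -integral_beta_half -integralZl//=.
  by apply: eq_integral => u _; rewrite -EFinM; congr EFin; rewrite /w; ring.
exact: integrable_moment.
Qed.

(** Dominated convergence: the partial sums of each binomial series are bounded
    by [(1 - `|tnth x j|)^-1] uniformly on the interval. *)
Lemma cvg_integral_partial_sum n (x : n.-tuple R) :
  (forall j, `|tnth x j| < 1) ->
  (\int[mu]_(u in `]0%R, 1%R[)
    (w u * \prod_j binom_half N (tnth x j * u))%:E @[N --> \oo] -->
   \int[mu]_(u in `]0%R, 1%R[) (euler_integrand x u)%:E)%E.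
Proof.
move=> x1.
have xu1 j u : 0 < u -> u < 1 -> `|tnth x j * u| <= `|tnth x j|.
  by move=> u0 u1; rewrite normrM (gtr0_norm u0) ler_piMr// ltW.
pose C := \prod_j (1 - `|tnth x j|)^-1.
have [] // := @dominated_convergence _ _ R mu `]0%R, 1%R[ _
  (fun N u => (w u * \prod_j binom_half N (tnth x j * u))%:E)
  (fun u => (euler_integrand x u)%:E) (fun u => (C%:E * (u ^+ 0 * w u)%:E)%E).
- move=> N; apply/measurable_EFinP.
  apply: subspace_continuous_measurable_fun => //.
  apply: continuous_in_subspaceT => u; rewrite inE/= in_itv/= => /andP[u0 _].
  apply: cvgM; first exact: continuous_semicircle_weight.
  apply: cvg_big => [|j _]; first exact: mul_continuous.
  apply: (@continuous_comp _ _ _ (fun v => tnth x j * v) (binom_half N)).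
    by apply: cvgM; [exact: cvg_cst|exact: cvg_id].
  exact: is_derive_continuous (is_derive_binom_half _ _).
- apply/measurable_EFinP; apply: measurable_euler_integrand => j.
  exact: le_lt_trans (ler_norm _) (x1 j).
- apply: aeW => u; rewrite /= in_itv/= => /andP[u0 u1].
  apply: cvg_EFin; first exact: nearW.
  apply: cvgM; first exact: cvg_cst.
  rewrite -prodfV; apply: cvg_big => [|j _]; first exact: mul_continuous.
  by apply: cvg_binom_half; apply: le_lt_trans (x1 j); exact: xu1.
- by apply: integrableZl => //; exact: integrable_moment.
- apply: aeW => u N; rewrite /= in_itv/= => /andP[u0 u1].
  rewrite lee_fin expr0 mul1r normrM (ger0_norm (semicircle_weight_ge0 _)).
  rewrite mulrC ler_wpM2r ?semicircle_weight_ge0// normr_prod.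
  apply: ler_prod => j _; rewrite normr_ge0/=.
  by apply: binom_half_bounded => //; exact: xu1.
Qed.

End lauricella_half.

Section euler_integral_bounds.
Context {R : realType}.
Local Notation mu := (@lebesgue_measure R).
Variables (n : nat) (x : n.-tuple R).
Hypothesis x_lt1 : forall j, tnth x j < 1.

Let lo := \prod_j Num.sqrt (Num.min 1 (1 - tnth x j)).
Let hi := \prod_j Num.sqrt (Num.max 1 (1 - tnth x j)).

Let lo_gt0 : 0 < lo.
Proof.
by apply: prodr_gt0 => j _; rewrite sqrtr_gt0 lt_min ltr01 subr_gt0 x_lt1.
Qed.

Let hi_gt0 : 0 < hi.
Proof. by apply: prodr_gt0 => j _; rewrite sqrtr_gt0 lt_max ltr01. Qed.

(* Each factor is affine in u, hence lies between its values at 0 and 1. *)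
Let prod_bounds u : 0 < u < 1 ->
  lo <= \prod_j Num.sqrt (1 - tnth x j * u) <= hi.
Proof.
move=> /andP[u0 u1].
have E j : 1 - tnth x j * u = (1 - u) * 1 + u * (1 - tnth x j) by ring.
have u1' : 0 <= 1 - u by rewrite subr_ge0 ltW.
apply/andP; split; apply: ler_prod => j _; rewrite sqrtr_ge0/=;
  apply: ler_wsqrtr; rewrite E.
  set m := Num.min _ _; have -> : m = (1 - u) * m + u * m by ring.
  by rewrite lerD// ler_wpM2l// ?(ltW u0)// ge_min lexx ?orbT.
set m := Num.max _ _; have -> : m = (1 - u) * m + u * m by ring.
by rewrite lerD// ler_wpM2l// ?(ltW u0)// le_max lexx ?orbT.
Qed.

Let bounds u : 0 < u < 1 ->
  hi^-1 * semicircle_weight u <= euler_integrand x u <=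
  lo^-1 * semicircle_weight u.
Proof.
move=> u01; have /andP[l h] := prod_bounds u01.
have P0 := lt_le_trans lo_gt0 l.
rewrite /euler_integrand ![_^-1 * _]mulrC.
by rewrite !ler_wpM2l ?semicircle_weight_ge0// lef_pV2 ?posrE.
Qed.

Let integrable_weight (c : R) :
  mu.-integrable `]0 : R, 1[ (fun u => (c * semicircle_weight u)%:E).
Proof.
apply: eq_integrable (integrableZl _ c (integrable_moment 0)) => //.
by move=> u _; rewrite /= expr0 mul1r.
Qed.

Lemma integrable_euler_integrand :
  mu.-integrable `]0 : R, 1[ (fun u => (euler_integrand x u)%:E).
Proof.
apply: le_integrable (integrable_weight lo^-1) => //.
  by apply/measurable_EFinP; exact: measurable_euler_integrand.
move=> u; rewrite /= in_itv/= => /bounds/andP[_].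
rewrite lee_fin !ger0_norm ?euler_integrand_ge0//.
by rewrite mulr_ge0 ?semicircle_weight_ge0// invr_ge0 ltW.
Qed.

(** This rules out the division by 0 in the final quotient. *)
Lemma euler_integral_gt0 :
  0 < \int[mu]_(u in `]0, 1[) euler_integrand x u.
Proof.
have W0 : \int[mu]_(u in `]0, 1[) (hi^-1 * semicircle_weight u) =
    hi^-1 * (pi / 2).
  rewrite RintegralZl//; last first.
    apply: eq_integrable (integrable_weight 1) => //.
    by move=> u _; rewrite /= mul1r.
  congr (_ * _); have := @integral_beta_half R 0.
  rewrite /pochhammer !big_ord0 divr1 mulr1 /Rintegral => E.
  rewrite -[RHS]/(fine (pi / 2)%:E) -E; congr fine.
  by apply: eq_integral => u _; rewrite expr0 mul1r.
apply: (@lt_le_trans _ _ (hi^-1 * (pi / 2))).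
  by rewrite mulr_gt0 ?invr_gt0// divr_gt0// pi_gt0.
rewrite -W0; apply: le_Rintegral => //.
- exact: integrable_weight.
- exact: integrable_euler_integrand.
- by move=> u; rewrite /= in_itv/= => /bounds/andP[].
Qed.

End euler_integral_bounds.

Section lauricella_euler_integral.
Context {R : realType}.
Local Notation mu := (@lebesgue_measure R).
Variables (n : nat) (beta x : n.-tuple R).
Hypotheses (beta_half : forall j, tnth beta j = 2^-1)
  (x_lt1 : forall j, tnth x j < 1).

Let I := \int[mu]_(u in `]0, 1[) euler_integrand x u.

Let pi_neq0 : pi != 0 :> R.
Proof. by rewrite gt_eqF// pi_gt0. Qed.

Lemma lauricellaD_series_half : (forall j, `|tnth x j| < 1) ->
  lauricellaD_series 2^-1 beta 2 x = 2 / pi * I.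
Proof.
move=> x1; have cvgI := cvg_integral_partial_sum x1.
rewrite /lauricellaD_series; apply/cvg_lim => //.
set S := fun N : nat => \sum_(m : {ffun 'I_n -> 'I_N}) _.
have -> : S = fun N => 2 / pi * (pi / 2 * S N).
  by apply/funext => N; move: (pi : R) pi_neq0 => p p0; field.
apply: cvgM; first exact: cvg_cst.
have EI : (\int[mu]_(u in `]0%R, 1%R[) (euler_integrand x u)%:E)%E = I%:E.
  rewrite /I /Rintegral fineK//; apply: integrable_fin_num => //.
  exact: integrable_euler_integrand.
move: cvgI; rewrite EI => /fine_cvg; apply: cvg_trans.
apply: near_eq_cvg; apply: nearW => N /=.
by rewrite (integral_partial_sum x N beta_half).
Qed.

Lemma lauricellaD_integral_half :
  lauricellaD_integral 2^-1 beta 2 x = 2 / pi * I.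
Proof.
have half : 1 - 2^-1 = 2^-1 :> R by field.
rewrite /lauricellaD_integral; congr (_ * _).
  have -> : (2 : R) - 2^-1 = 2^-1 + 1 by field.
  have -> : Gamma (2 : R) = 1.
    by rewrite -(_ : 1 + 1 = 2 :> R)// GammaD1// Gamma1 mulr1.
  rewrite GammaD1 ?invr_gt0// Gamma_half mulrCA -expr2 sqr_sqrtr ?pi_ge0//.
  by rewrite invfM invrK mul1r.
have E u : u \in `]0, 1[ -> u `^ (2^-1 - 1) * (1 - u) `^ (2 - 2^-1 - 1)
    / \prod_j (1 - tnth x j * u) `^ tnth beta j = euler_integrand x u.
  rewrite in_itv/= => /andP[u0 u1].
  have -> : (2 : R) - 2^-1 - 1 = 2^-1 by field.
  have -> : (2^-1 : R) - 1 = - 2^-1 by field.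
  rewrite powRN !powR12_sqrt ?subr_ge0 ?(ltW u0) ?(ltW u1)//.
  rewrite /euler_integrand /semicircle_weight [_^-1 * _]mulrC; congr (_ / _).
  apply: eq_bigr => j _.
  by rewrite beta_half powR12_sqrt// ltW// onem_mul_gt0.
rewrite /Rintegral integral_itv_bndoo; last first.
  apply/measurable_EFinP.
  apply: eq_measurable_fun (measurable_euler_integrand x_lt1).
  by move=> u; rewrite inE/= => /E.
by congr fine; apply: eq_integral => u; rewrite inE/= => /E ->.
Qed.

(** The series and the integral that define F_D in different regions agree, so
    that no case distinction on the arguments is left. *)
Lemma lauricellaD_half : lauricellaD 2^-1 beta 2 x = 2 / pi * I.
Proof.
rewrite /lauricellaD; case: ifPn => [/forallP x1|_].
  exact: lauricellaD_series_half.
exact: lauricellaD_integral_half.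
Qed.

End lauricella_euler_integral.

(** * The elliptic integral in the palindromic variable *)

Section elliptic.
Context {R : realType}.
Local Notation mu := (@lebesgue_measure R).
Implicit Types (k x s t : R).

Definition elliptic_integrand k x : R :=
  (Num.sqrt ((1 - x ^+ 2) * (1 - k ^+ 2 * x ^+ 2)))^-1.

Lemma elliptic_radicand_gt0 k x : 0 <= k < 1 -> 0 < x < 1 ->
  0 < (1 - x ^+ 2) * (1 - k ^+ 2 * x ^+ 2).
Proof.
move=> /andP[k0 k1] /andP[x0 x1].
have kx : k * x < 1 by nra.
have kx0 : 0 <= k * x by nra.
by rewrite -exprMn; apply: mulr_gt0; nra.
Qed.

Lemma continuous_elliptic_integrand k x : 0 <= k < 1 -> 0 < x < 1 ->
  {for x, continuous (elliptic_integrand k)}.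
Proof.
move=> k01 x01; apply: cvgV.
  by rewrite gt_eqF// sqrtr_gt0 elliptic_radicand_gt0.
apply: (@continuous_comp _ _ _
    (fun y : R => (1 - y ^+ 2) * (1 - k ^+ 2 * y ^+ 2)) Num.sqrt); last first.
  exact: sqrt_continuous.
apply: cvgM; (apply: cvgB; first exact: cvg_cst).
  exact: exprn_continuous.
by apply: cvgM; [exact: cvg_cst|exact: exprn_continuous].
Qed.

Lemma measurable_elliptic_integrand k : 0 <= k < 1 ->
  measurable_fun `]0 : R, 1[ (elliptic_integrand k).
Proof.
move=> k01; apply: subspace_continuous_measurable_fun => //.
apply: continuous_in_subspaceT => x; rewrite inE/= in_itv/= => x01.
exact: continuous_elliptic_integrand.
Qed.

Lemma elliptic_integrand_ge0 k x : 0 <= elliptic_integrand k x.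
Proof. by rewrite invr_ge0 sqrtr_ge0. Qed.

(** The substitution [x = 1 - t ^+ 2] removes the singularity at 1. *)
Lemma integral_elliptic_lty k : 0 <= k < 1 ->
  (\int[mu]_(x in `]0%R, 1%R[) (elliptic_integrand k x)%:E < +oo)%E.
Proof.
move=> k01; have /andP[k0 k1] := k01.
have sq01 t : t \in `]0, 1[ -> 0 < 1 - t ^+ 2 < 1.
  by rewrite in_itv/= => /andP[t0 t1]; apply/andP; split; nra.
have cF : continuous (fun t : R => 1 - t ^+ 2).
  by move=> t; apply: cvgB; [exact: cvg_cst|exact: exprn_continuous].
have subst : (\int[mu]_(x in `]0%R, 1%R[) (elliptic_integrand k x)%:E =
    \int[mu]_(t in `]0%R, 1%R[)
      (elliptic_integrand k (1 - t ^+ 2) * - - (2 * t))%:E)%E.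
  have := @decreasing_ge0_change_of_variables R (fun t => 1 - t ^+ 2)
    (fun t => - (2 * t)) (elliptic_integrand k) 0 1 ltr01.
  rewrite expr0n expr1n/= subr0 subrr; apply.
  - exact: continuous_subspaceT.
  - move=> t _; have dX := is_derive_exprn 2 (is_derive_id t (1 : R)).
    by apply: is_derive_eq; rewrite /=; ring.
  - by move=> t _; apply: cvgN; apply: cvgM; [exact: cvg_cst|exact: cvg_id].
  - by move=> t /sq01; exact: continuous_elliptic_integrand.
  - by move=> t _; exact: elliptic_integrand_ge0.
  - by move=> t; rewrite in_itv/= => /andP[t0 _]; rewrite oppr_lt0 mulr_gt0.
pose M := 2 / Num.sqrt (1 - k ^+ 2).
have k2 : 0 < 1 - k ^+ 2 by nra.
rewrite subst.
apply: (@le_lt_trans _ _ (\int[mu]_(x in `]0%R, 1%R[) M%:E)%E); last first.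
  rewrite integral_cst//= lebesgue_measure_itv/= lte_fin ltr01.
  by rewrite -EFinB -EFinM ltry.
apply: ge0_le_integral => //.
- move=> t; rewrite /= in_itv/= => /andP[t0 _].
  by rewrite lee_fin mulr_ge0 ?elliptic_integrand_ge0// opprK mulr_ge0// ltW.
- apply/measurable_EFinP; apply: subspace_continuous_measurable_fun => //.
  apply: continuous_in_subspaceT => t; rewrite inE/= => /sq01 t01.
  apply: cvgM.
    apply: (@continuous_comp _ _ _ (fun t : R => 1 - t ^+ 2)); first exact: cF.
    exact: continuous_elliptic_integrand.
  by do 2!apply: cvgN; apply: cvgM; [exact: cvg_cst|exact: cvg_id].
- move=> t; rewrite /= in_itv/= => /andP[t0 t1]; rewrite lee_fin opprK.
  rewrite /elliptic_integrand mulrC -ler_pdivlMl ?mulr_gt0//.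
  have -> : (2 * t)^-1 * M = (Num.sqrt (t ^+ 2 * (1 - k ^+ 2)))^-1.
    rewrite sqrtrM ?sqr_ge0// sqrtr_sqr gtr0_norm// /M.
    by field; rewrite gt_eqF ?sqrtr_gt0// gt_eqF.
  rewrite lef_pV2 ?posrE ?sqrtr_gt0//; last 2 first.
  - by apply: elliptic_radicand_gt0 => //; apply: sq01; rewrite in_itv/= t0.
  - by rewrite mulr_gt0// exprn_gt0.
  have /sq01/andP[t2 t21] : t \in `]0, 1[ by rewrite in_itv/= t0.
  apply: ler_wsqrtr; apply: ler_pM; rewrite ?sqr_ge0 ?(ltW k2)//.
    rewrite -subr_ge0.
    have -> : 1 - (1 - t ^+ 2) ^+ 2 - t ^+ 2 = t ^+ 2 * (1 - t ^+ 2) by ring.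
    by rewrite mulr_ge0 ?sqr_ge0// ltW.
  by rewrite lerD2l lerN2 ler_piMr ?sqr_ge0// exprn_ile1// ltW.
Qed.

Lemma ellipticKE k : 0 <= k < 1 ->
  ellipticK k = \int[mu]_(x in `]0, 1[) elliptic_integrand k x.
Proof.
move=> k01; rewrite /ellipticK /Rintegral integral_itv_bndoo//.
by apply/measurable_EFinP; exact: measurable_elliptic_integrand.
Qed.

(** Up to the factor s^4 / (a b)^2, the product of b^2 q - (1 + b^4) and
    a^2 q - (1 + a^4) for q = s^2 + s^-2; hence the symmetry between s and its
    inverse that yields the two elliptic quotients. *)
Definition palindromic_radicand (a b s : R) : R :=
  (1 - b ^+ 2 * s ^+ 2) * (1 - s ^+ 2 / b ^+ 2) *
  ((1 - a ^+ 2 * s ^+ 2) * (1 - s ^+ 2 / a ^+ 2)).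

(** With x = (b - sigma / b) s / (1 - sigma s^2) and sigma^2 = 1, the variable
    1 / x is, up to a constant, s^-1 - sigma s. The square of the latter is
    s^2 + s^-2 - 2 sigma, so that each factor of the radicand of K is, up
    to a square, the product of two factors of [palindromic_radicand], whatever
    the sign sigma. *)
Section palindromic_substitution.
Variables (a b sigma : R).
Hypotheses (a1 : 1 < a) (ab : a < b) (sigma2 : sigma ^+ 2 = 1).

Let p := b - sigma / b.
Let k := (a - sigma / a) / (b - sigma / b).
Let F s := p * s / (1 - sigma * s ^+ 2).
Let f s := p * (1 + sigma * s ^+ 2) / (1 - sigma * s ^+ 2) ^+ 2.

Let a_gt0 : 0 < a. Proof. exact: lt_trans a1. Qed.
Let b_gt0 : 0 < b. Proof. exact: lt_trans ab. Qed.
Let b_gt1 : 1 < b. Proof. exact: lt_trans ab. Qed.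
Let binv_lt1 : b^-1 < 1. Proof. by rewrite invf_lt1. Qed.

Let sigmaP : sigma = 1 \/ sigma = -1.
Proof.
have /eqP := sigma2; rewrite sqrf_eq1 => /orP[]/eqP ->; first by left.
by right.
Qed.

Let sub_sigma_gt0 c : 1 < c -> 0 < c - sigma / c.
Proof.
move=> c1; have c0 : 0 < c by apply: lt_trans c1.
rewrite subr_gt0 ltr_pdivrMr//.
by case: sigmaP => ->; nra.
Qed.

Let p_gt0 : 0 < p. Proof. exact: sub_sigma_gt0. Qed.

Let k01 : 0 <= k < 1.
Proof.
rewrite divr_ge0 ?(ltW (sub_sigma_gt0 _))//= ltr_pdivrMr ?sub_sigma_gt0// mul1r.
have -> : a - sigma / a = (a ^+ 2 - sigma) / a by field; rewrite gt_eqF.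
have -> : b - sigma / b = (b ^+ 2 - sigma) / b by field; rewrite gt_eqF.
rewrite ltr_pdivrMr// mulrAC ltr_pdivlMr// -subr_gt0.
have -> : (b ^+ 2 - sigma) * a - (a ^+ 2 - sigma) * b =
    (b - a) * (a * b + sigma) by ring.
rewrite mulr_gt0 ?subr_gt0//.
have ab1 : 1 < a * b by rewrite mulr_egt1.
by case: sigmaP => ->; lra.
Qed.

Let sqr_lt1 s : 0 <= s <= b^-1 -> 0 <= s ^+ 2 < 1.
Proof.
by move=> /andP[s0 sb]; rewrite sqr_ge0 exprn_ilt1// (le_lt_trans sb).
Qed.

Let denom_gt0 s : 0 <= s <= b^-1 -> 0 < 1 - sigma * s ^+ 2.
Proof. by move=> /sqr_lt1/andP[s0 s1]; case: sigmaP => ->; lra. Qed.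

Let numer_gt0 s : 0 <= s <= b^-1 -> 0 < 1 + sigma * s ^+ 2.
Proof. by move=> /sqr_lt1/andP[s0 s1]; case: sigmaP => ->; lra. Qed.

Let dF s : 0 <= s <= b^-1 -> is_derive s 1 F (f s).
Proof.
move=> /denom_gt0 d0; have dX := is_derive_exprn 2 (is_derive_id s (1 : R)).
have dD : is_derive s 1 (fun t => 1 - sigma * t ^+ 2) (- (sigma * (2 * s))).
  by apply: is_derive_eq; rewrite /GRing.scale/=; ring.
have dV := @is_deriveV R (fun t => 1 - sigma * t ^+ 2) s _ 1 (lt0r_neq0 d0) dD.
have dN : is_derive s 1 (fun t => p * t) p.
  by apply: is_derive_eq; rewrite /GRing.scale/=; ring.
apply: (is_derive_eq (is_deriveM dN dV)).
rewrite /f /GRing.scale/=.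
by field; rewrite gt_eqF.
Qed.

Let cF s : 0 <= s <= b^-1 -> {for s, continuous F}.
Proof. by move=> /dF; exact: is_derive_continuous. Qed.

Let cf s : 0 <= s <= b^-1 -> {for s, continuous f}.
Proof.
move=> sb; apply: cvgM.
  apply: cvgM; first exact: cvg_cst.
  apply: cvgD; first exact: cvg_cst.
  by apply: cvgM; [exact: cvg_cst|exact: exprn_continuous].
apply: cvgV; first by rewrite expf_neq0// lt0r_neq0// denom_gt0.
apply: (@continuous_comp _ _ _ (fun t : R => 1 - sigma * t ^+ 2)
  (fun t => t ^+ 2)); last exact: exprn_continuous.
apply: cvgB; first exact: cvg_cst.
by apply: cvgM; [exact: cvg_cst|exact: exprn_continuous].
Qed.

Let f_gt0 s : 0 <= s <= b^-1 -> 0 < f s.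
Proof.
move=> sb; rewrite divr_gt0 ?exprn_gt0 ?denom_gt0//.
by rewrite mulr_gt0 ?numer_gt0.
Qed.

Let itvW s : s \in `]0, b^-1[ -> 0 <= s <= b^-1.
Proof. by rewrite in_itv/= => /andP[/ltW -> /ltW ->]. Qed.

Let F0 : F 0 = 0. Proof. by rewrite /F mulr0 mul0r. Qed.

Let F1 : F b^-1 = 1.
Proof.
have := @denom_gt0 b^-1; rewrite lexx invr_ge0 ltW// => /(_ isT) d0.
rewrite /F /p; field; rewrite gt_eqF//=.
have -> : b ^+ 2 - sigma = b ^+ 2 * (1 - sigma * b^-1 ^+ 2).
  by field; rewrite gt_eqF.
by rewrite mulf_neq0 ?expf_neq0 ?gt_eqF.
Qed.

Let F01 s : s \in `]0, b^-1[ -> 0 < F s < 1.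
Proof.
move=> /[dup] sb; rewrite in_itv/= => /andP[s0 s1].
have d0 := denom_gt0 (itvW sb).
rewrite divr_gt0 ?mulr_gt0//= /F ltr_pdivrMr// mul1r -subr_gt0.
have -> : 1 - sigma * s ^+ 2 - p * s = (b^-1 - s) * (b + sigma * s).
  by rewrite /p; field; rewrite gt_eqF.
rewrite mulr_gt0 ?subr_gt0//.
by case: sigmaP => ->; have := b_gt1; have := binv_lt1; lra.
Qed.

Let radicand s : s \in `]0, b^-1[ ->
  (1 - F s ^+ 2) * (1 - k ^+ 2 * F s ^+ 2) =
  palindromic_radicand a b s / (1 - sigma * s ^+ 2) ^+ 4.
Proof.
move=> sb; have d0 := denom_gt0 (itvW sb).
have sq c : 0 < c -> (1 - sigma * s ^+ 2) ^+ 2 - (c - sigma / c) ^+ 2 * s ^+ 2 =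
    (1 - c ^+ 2 * s ^+ 2) * (1 - s ^+ 2 / c ^+ 2).
  move=> c0; transitivity
    (1 + sigma ^+ 2 * s ^+ 4 - (c ^+ 2 + sigma ^+ 2 / c ^+ 2) * s ^+ 2).
    by field; rewrite gt_eqF.
  by rewrite sigma2; field; rewrite gt_eqF.
have kp : k * p = a - sigma / a by rewrite /k divfK// gt_eqF.
have -> : k ^+ 2 * F s ^+ 2 =
    (a - sigma / a) ^+ 2 * s ^+ 2 / (1 - sigma * s ^+ 2) ^+ 2.
  by rewrite -kp /F; field; rewrite gt_eqF.
rewrite /palindromic_radicand -!sq// -/p /F.
by field; rewrite !gt_eqF.
Qed.

Let h s := (1 + sigma * s ^+ 2) / Num.sqrt (palindromic_radicand a b s).

Let palindromic_radicand_gt0 s :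
  s \in `]0, b^-1[ -> 0 < palindromic_radicand a b s.
Proof.
move=> sb; have d0 := denom_gt0 (itvW sb).
have := elliptic_radicand_gt0 k01 (F01 sb); rewrite radicand//.
by rewrite pmulr_lgt0// invr_gt0 exprn_gt0.
Qed.

Let integrandE s : s \in `]0, b^-1[ ->
  elliptic_integrand k (F s) * f s = p * h s.
Proof.
move=> sb; have d0 := denom_gt0 (itvW sb).
have Q0 := palindromic_radicand_gt0 sb.
rewrite /elliptic_integrand radicand//.
rewrite sqrtrM ?(ltW Q0)// sqrtrV ?exprn_ge0 ?(ltW d0)//.
have -> : (1 - sigma * s ^+ 2) ^+ 4 = ((1 - sigma * s ^+ 2) ^+ 2) ^+ 2.
  by rewrite -exprM.
rewrite sqrtr_sqr ger0_norm ?sqr_ge0// /h /f.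
by field; rewrite !gt_eqF// sqrtr_gt0.
Qed.

Let integral_subst :
  (\int[mu]_(x in `]0%R, 1%R[) (elliptic_integrand k x)%:E =
   \int[mu]_(s in `]0%R, b^-1%R[) (p * h s)%:E)%E.
Proof.
transitivity (\int[mu]_(s in `]0%R, b^-1%R[)
    (elliptic_integrand k (F s) * f s)%:E)%E; last first.
  by apply: eq_integral => s; rewrite inE => /integrandE ->.
have b0 : 0 < b^-1 by rewrite invr_gt0.
have := @increasing_ge0_change_of_variables R F f (elliptic_integrand k) _ _ b0.
rewrite F0 F1; apply.
- by apply: continuous_within_segment => s; rewrite in_itv/=; exact: cF.
- by move=> s /itvW; exact: dF.
- by move=> s /itvW; exact: cf.
- by move=> s /F01; exact: continuous_elliptic_integrand.
- by move=> s _; exact: elliptic_integrand_ge0.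
- by move=> s /itvW; exact: f_gt0.
Qed.

Let continuous_h s : s \in `]0, b^-1[ -> {for s, continuous h}.
Proof.
move=> sb; have cB (c : R) : {for s, continuous (fun t => 1 - c * t ^+ 2)}.
  apply: cvgB; first exact: cvg_cst.
  by apply: cvgM; [exact: cvg_cst|exact: exprn_continuous].
have cBV (c : R) : {for s, continuous (fun t => 1 - t ^+ 2 / c)}.
  apply: cvgB; first exact: cvg_cst.
  by apply: cvgM; [exact: exprn_continuous|exact: cvg_cst].
apply: cvgM.
  apply: cvgD; first exact: cvg_cst.
  by apply: cvgM; [exact: cvg_cst|exact: exprn_continuous].
apply: cvgV; first by rewrite gt_eqF// sqrtr_gt0 palindromic_radicand_gt0.
apply: (@continuous_comp _ _ _ (palindromic_radicand a b) Num.sqrt).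
  by apply: cvgM; apply: cvgM; by [exact: cB|exact: cBV].
exact: sqrt_continuous.
Qed.

Let h_ge0 s : s \in `]0, b^-1[ -> 0 <= h s.
Proof. by move=> /itvW/numer_gt0/ltW ?; rewrite divr_ge0 ?sqrtr_ge0. Qed.

Lemma integrable_palindromic :
  mu.-integrable `]0 : R, b^-1[ (fun s =>
    ((1 + sigma * s ^+ 2) / Num.sqrt (palindromic_radicand a b s))%:E).
Proof.
have mh : measurable_fun `]0, b^-1[ h.
  apply: subspace_continuous_measurable_fun => //.
  by apply: continuous_in_subspaceT => s; rewrite inE; exact: continuous_h.
have iph : mu.-integrable `]0, b^-1[ (fun s => (p * h s)%:E).
  apply/integrableP; split.
    by apply/measurable_EFinP; exact: measurable_funM.
  have -> : (\int[mu]_(s in `]0%R, b^-1%R[) `|(p * h s)%:E| =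
      \int[mu]_(s in `]0%R, b^-1%R[) (p * h s)%:E)%E.
    apply: eq_integral => s; rewrite inE => sb.
    by rewrite /= ger0_norm// mulr_ge0 ?h_ge0// ltW.
  by rewrite -integral_subst integral_elliptic_lty.
apply: eq_integrable (integrableZl _ p^-1 iph) => //.
by move=> s _; rewrite /= -EFinM mulKf// gt_eqF.
Qed.

Lemma ellipticK_palindromic :
  ellipticK ((a - sigma / a) / (b - sigma / b)) =
  (b - sigma / b) * \int[mu]_(s in `]0, b^-1[)
    ((1 + sigma * s ^+ 2) / Num.sqrt (palindromic_radicand a b s)).
Proof.
rewrite -/p -/k ellipticKE//.
transitivity (\int[mu]_(s in `]0, b^-1[) (p * h s)).
  by rewrite /Rintegral integral_subst.
by rewrite RintegralZl//; exact: integrable_palindromic.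
Qed.

End palindromic_substitution.

End elliptic.

(** * Euler's integral in the palindromic variable *)

Section lauricella_substitution.
Context {R : realType}.
Local Notation mu := (@lebesgue_measure R).
Variables (a b : R).
Hypotheses (a1 : 1 < a) (ab : a < b).

Let a_gt0 : 0 < a. Proof. exact: lt_trans a1. Qed.
Let b_gt0 : 0 < b. Proof. exact: lt_trans ab. Qed.
Let b_gt1 : 1 < b. Proof. exact: lt_trans ab. Qed.

Let X := [tuple 1 / (1 - b ^+ 4); 1 / (1 - a ^+ 2 * b ^+ 2);
                a ^+ 2 / (a ^+ 2 - b ^+ 2)].

Let d1_gt0 : 0 < b ^+ 4 - 1.
Proof. by rewrite subr_gt0 exprn_egt1. Qed.

Let d2_gt0 : 0 < a ^+ 2 * b ^+ 2 - 1.
Proof. by rewrite subr_gt0 -exprMn exprn_egt1// mulr_egt1. Qed.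

Let d3_gt0 : 0 < b ^+ 2 - a ^+ 2.
Proof.
by rewrite subr_sqr mulr_gt0 ?subr_gt0// addr_gt0.
Qed.

Lemma lauricella_args_lt1 j : tnth X j < 1.
Proof.
case: j => -[|[|[|//]]] ?; rewrite (tnth_nth 0)/=.
- by rewrite (lt_trans _ ltr01)// mul1r invr_lt0 -oppr_gt0 opprB.
- by rewrite (lt_trans _ ltr01)// mul1r invr_lt0 -oppr_gt0 opprB.
- rewrite (lt_trans _ ltr01)// pmulr_rlt0 ?exprn_gt0//.
  by rewrite invr_lt0 -oppr_gt0 opprB.
Qed.

Let sqrt_scaled (c d y : R) : 0 <= c -> 0 <= y -> 0 <= d ->
  Num.sqrt (c ^+ 2 * y / d) = c * Num.sqrt y / Num.sqrt d.
Proof.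
move=> c0 y0 d0; rewrite sqrtrM ?mulr_ge0 ?sqr_ge0// sqrtrM ?sqr_ge0//.
by rewrite sqrtr_sqr ger0_norm// sqrtrV.
Qed.

Let C := Num.sqrt ((b ^+ 4 - 1) * (a ^+ 2 * b ^+ 2 - 1) * (b ^+ 2 - a ^+ 2)).

Let Q := palindromic_radicand a b.

Let integrandE s : 0 < s < b^-1 ->
  euler_integrand X (1 - b ^+ 2 * s ^+ 2) * (2 * b ^+ 2 * s) =
  C / (a * b) * (2 * s ^+ 2 / Num.sqrt (Q s)).
Proof.
move=> /andP[s0 sb].
have bs1 : b * s < 1 by rewrite -ltr_pdivlMl// mulr1.
have as1 : a * s < 1 by rewrite (lt_trans _ bs1)// ltr_pM2r.
have s1 : s < 1 by rewrite (lt_trans sb)// invf_lt1.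
have X0 : 0 < 1 - b ^+ 2 * s ^+ 2.
  by rewrite -exprMn subr_gt0 exprn_ilt1// ltW// mulr_gt0.
have X2 : 0 < 1 - a ^+ 2 * s ^+ 2.
  by rewrite -exprMn subr_gt0 exprn_ilt1// ltW// mulr_gt0.
have X1 c : 1 < c -> 0 < 1 - s ^+ 2 / c ^+ 2.
  move=> c1; have c0 : 0 < c by apply: lt_trans c1.
  rewrite -expr_div_n subr_gt0 exprn_ilt1 ?divr_ge0 ?(ltW s0) ?(ltW c0)//.
  by rewrite ltr_pdivrMr// mul1r (lt_trans s1).
have [X0' X2'] := (ltW X0, ltW X2).
have [X1a X1b] := (ltW (X1 a a1), ltW (X1 b b_gt1)).
have d1n : 1 - b ^+ 4 != 0 by rewrite -opprB oppr_eq0 gt_eqF.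
have d2n : 1 - a ^+ 2 * b ^+ 2 != 0 by rewrite -opprB oppr_eq0 gt_eqF.
have d3n : a ^+ 2 - b ^+ 2 != 0 by rewrite -opprB oppr_eq0 gt_eqF.
have aneq0 : a != 0 by rewrite gt_eqF.
have bneq0 : b != 0 by rewrite gt_eqF.
rewrite /euler_integrand /semicircle_weight !big_ord_recl big_ord0 mulr1.
rewrite !(tnth_nth 0)/=.
have -> : 1 - (1 - b ^+ 2 * s ^+ 2) = (b * s) ^+ 2 by ring.
have -> : 1 - 1 / (1 - b ^+ 4) * (1 - b ^+ 2 * s ^+ 2) =
    (b ^+ 2) ^+ 2 * (1 - s ^+ 2 / b ^+ 2) / (b ^+ 4 - 1).
  by field; rewrite bneq0 d1n gt_eqF.
have -> : 1 - 1 / (1 - a ^+ 2 * b ^+ 2) * (1 - b ^+ 2 * s ^+ 2) =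
    (a * b) ^+ 2 * (1 - s ^+ 2 / a ^+ 2) / (a ^+ 2 * b ^+ 2 - 1).
  by field; rewrite !exprMn aneq0 d2n gt_eqF.
have -> : 1 - a ^+ 2 / (a ^+ 2 - b ^+ 2) * (1 - b ^+ 2 * s ^+ 2) =
    b ^+ 2 * (1 - a ^+ 2 * s ^+ 2) / (b ^+ 2 - a ^+ 2).
  by field; rewrite d3n gt_eqF.
rewrite sqrtr_sqr gtr0_norm ?mulr_gt0//.
rewrite !sqrt_scaled ?sqr_ge0 ?mulr_ge0 ?(ltW a_gt0) ?(ltW b_gt0)
  ?(ltW d1_gt0) ?(ltW d2_gt0) ?(ltW d3_gt0)//.
rewrite /C /Q /palindromic_radicand.
rewrite !sqrtrM ?mulr_ge0 ?(ltW d1_gt0) ?(ltW d2_gt0)//.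
have nz y : 0 < y -> Num.sqrt y != 0 by move=> y0; rewrite gt_eqF// sqrtr_gt0.
by field; rewrite aneq0 bneq0 !nz ?X1.
Qed.

Let cF (s : R) : {for s, continuous (fun t : R => 1 - b ^+ 2 * t ^+ 2)}.
Proof.
apply: cvgB; first exact: cvg_cst.
by apply: cvgM; [exact: cvg_cst|exact: exprn_continuous].
Qed.

Let integral_subst :
  (\int[mu]_(u in `]0%R, 1%R[) (euler_integrand X u)%:E =
   \int[mu]_(s in `]0%R, b^-1%R[)
     (C / (a * b) * (2 * s ^+ 2 / Num.sqrt (Q s)))%:E)%E.
Proof.
transitivity (\int[mu]_(s in `]0%R, b^-1%R[)
    (euler_integrand X (1 - b ^+ 2 * s ^+ 2) * - - (2 * b ^+ 2 * s))%:E)%E;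
  last first.
  apply: eq_integral => s; rewrite inE/= in_itv/= => /integrandE <-.
  by rewrite opprK.
have b0 : 0 < b^-1 by rewrite invr_gt0.
have F01 s : s \in `]0, b^-1[ -> 0 < 1 - b ^+ 2 * s ^+ 2 < 1.
  rewrite in_itv/= => /andP[s0 sb].
  have bs1 : b * s < 1 by rewrite -ltr_pdivlMl// mulr1.
  rewrite -exprMn subr_gt0 exprn_ilt1 ?mulr_ge0 ?(ltW b_gt0) ?(ltW s0)//=.
  by rewrite ltrBlDr ltrDl exprn_gt0// mulr_gt0.
have := @decreasing_ge0_change_of_variables R
  (fun s => 1 - b ^+ 2 * s ^+ 2) (fun s => - (2 * b ^+ 2 * s))
  (euler_integrand X) _ _ b0.
rewrite expr0n/= mulr0 subr0 -exprMn divff ?gt_eqF// expr1n subrr; apply.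
- by apply: continuous_within_segment => s _; exact: cF.
- move=> s _; have dX := is_derive_exprn 2 (is_derive_id s (1 : R)).
  by apply: is_derive_eq; rewrite /GRing.scale/=; ring.
- by move=> s _; apply: cvgN; apply: cvgM; [exact: cvg_cst|exact: cvg_id].
- move=> s /F01/andP[u0 u1].
  by apply: continuous_euler_integrand => //; exact: lauricella_args_lt1.
- by move=> s _; exact: euler_integrand_ge0.
- move=> s; rewrite in_itv/= => /andP[s0 _].
  by rewrite oppr_lt0 !mulr_gt0// exprn_gt0.
Qed.

(** The substitution u = 1 - b^2 s^2 carries the branch points 0 and 1 / x_j
    of Euler's integrand to the zeros of [palindromic_radicand], and leaves
    2 s^2 in the numerator, which is the difference of the numerators 1 + s^2
    and 1 - s^2 that belong to the two moduli. *)
Lemma integral_euler_palindromic :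
  \int[mu]_(u in `]0, 1[) euler_integrand X u =
  C / (a * b) *
  (\int[mu]_(s in `]0, b^-1[) ((1 + 1 * s ^+ 2) / Num.sqrt (Q s)) -
   \int[mu]_(s in `]0, b^-1[) ((1 + -1 * s ^+ 2) / Num.sqrt (Q s))).
Proof.
have i1 := integrable_palindromic a1 ab (expr1n R 2).
have i2 := integrable_palindromic a1 ab (etrans (sqrrN 1) (expr1n R 2)).
rewrite -RintegralB// -RintegralZl//; last exact: integrableB i1 i2.
rewrite /Rintegral integral_subst; congr fine; apply: eq_integral => s _.
by congr EFin; rewrite -/Q; ring.
Qed.

End lauricella_substitution.

Theorem theorem3p7 (R : realType) (a b : R) (ha : 1 < a) (hab : a < b) :
  pi = 2 / a
       * Num.sqrt ((b ^+ 2 - a ^+ 2) * (1 - a ^+ 2 * b ^+ 2) / (1 - b ^+ 4))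
       * (((1 + b ^+ 2) * ellipticK (b * (a ^+ 2 - 1) / (a * (b ^+ 2 - 1)))
           + (1 - b ^+ 2) * ellipticK (b * (a ^+ 2 + 1) / (a * (b ^+ 2 + 1))))
          / lauricellaD (1 / 2) [tuple 1 / 2; 1 / 2; 1 / 2] 2
              [tuple 1 / (1 - b ^+ 4); 1 / (1 - a ^+ 2 * b ^+ 2);
                     a ^+ 2 / (a ^+ 2 - b ^+ 2)]).
Proof.
have a0 : 0 < a by apply: lt_trans ha.
have b0 : 0 < b by apply: lt_trans hab.
have b1 : 1 < b by apply: lt_trans hab.
have beta_half j : tnth [tuple 1 / 2; 1 / 2; 1 / 2] j = 2^-1 :> R.
  by case: j => -[|[|[|//]]] ?; rewrite (tnth_nth 0)/= mul1r.
have x1 := lauricella_args_lt1 ha hab.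
rewrite [in lauricellaD _]mul1r (lauricellaD_half beta_half x1).
have I0 := euler_integral_gt0 x1.
have := integral_euler_palindromic ha hab.
move: I0; move: (\int[_]_(_ in _) euler_integrand _ _) => I I0 IE.
have K1 := ellipticK_palindromic ha hab (expr1n R 2).
have K2 := ellipticK_palindromic ha hab (etrans (sqrrN 1) (expr1n R 2)).
pose J e := \int[@lebesgue_measure R]_(s in `]0, b^-1[)
  ((1 + e * s ^+ 2) / Num.sqrt (palindromic_radicand a b s)).
rewrite -/(J 1) -/(J (-1)) in IE K1 K2.
rewrite !mul1r in K1; rewrite !mulN1r in K2.
have b2 : 0 < b ^+ 2 - 1 by rewrite subr_gt0 exprn_egt1.
have b2' : 0 < b ^+ 2 + 1 by rewrite ltr_wpDl// sqr_ge0.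
have D1 : 0 < b ^+ 4 - 1 by rewrite subr_gt0 exprn_egt1.
have -> : b * (a ^+ 2 - 1) / (a * (b ^+ 2 - 1)) = (a - a^-1) / (b - b^-1).
  by field; rewrite !gt_eqF.
have -> : b * (a ^+ 2 + 1) / (a * (b ^+ 2 + 1)) = (a - - a^-1) / (b - - b^-1).
  by field; rewrite !gt_eqF.
(* Multiplying and dividing by b^4 - 1 produces the square root that comes with
   Euler's integral. *)
have -> : (b ^+ 2 - a ^+ 2) * (1 - a ^+ 2 * b ^+ 2) / (1 - b ^+ 4) =
    (b ^+ 4 - 1) * (a ^+ 2 * b ^+ 2 - 1) * (b ^+ 2 - a ^+ 2) /
    (b ^+ 4 - 1) ^+ 2.
  by field; rewrite -[1 - _]opprB oppr_eq0 !gt_eqF.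
rewrite sqrtrM; last first.
  rewrite !mulr_ge0 ?(ltW D1)// subr_ge0.
    by rewrite -exprMn exprn_ege1// mulr_ege1 ?ltW.
  by rewrite ler_sqr ?nnegrE ?ltW.
rewrite sqrtrV ?sqr_ge0// sqrtr_sqr (gtr0_norm D1) K1 K2.
move: IE; move: (Num.sqrt _) (J 1) (J (-1)) => C J1 J2 IE.
have -> : (1 + b ^+ 2) * ((b - b^-1) * J1) +
    (1 - b ^+ 2) * ((b - - b^-1) * J2) = (b ^+ 4 - 1) / b * (J1 - J2).
  by field; rewrite gt_eqF.
have E : 2 / a * (C / (b ^+ 4 - 1)) * ((b ^+ 4 - 1) / b * (J1 - J2)) = 2 * I.
  by rewrite IE; field; rewrite !gt_eqF.
rewrite mulrA E; move: (pi : R) (pi_gt0 R) => p p0.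
by field; rewrite !gt_eqF.
Qed.
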